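(* Let $K$ be a number field with ring of integers $\mathscr O$, and let $\theta$ be a field automorphism of $K$ with $\theta^2=\mathrm{id}$. Equip $\mathscr O$ with the bilinear form $\mathrm{tr}_{K,\theta}(x,y):=\mathrm{Trace}_{K/\mathbb Q}(x\cdot\theta(y))$. Then the lattice $(\mathscr O,\mathrm{tr}_{K,\theta})$ is a root lattice if and only if the pair $K,\theta$ is one of the following: (1) $K=\mathbb Q$, $\theta=\mathrm{id}$; (2) $K=\mathbb Q(\sqrt{-3})$ and $\theta$ is complex conjugation; (3) $K=\mathbb Q(\sqrt{-1})$ and $\theta$ is complex conjugation.
   Context: A lattice is a pair $(L,b)$ with $L$ a free $\mathbb Z$-module of finite rank and $b\colon L\times L\to\mathbb Z$ a nondegenerate symmetric bilinear form. $\mathrm{tr}_{K,\theta}$ restricted to $\mathscr O\times\mathscr O$ takes integer values, so $(\mathscr O,\mathrm{tr}_{K,\theta})$ is a lattice of rank $[K:\mathbb Q]$. A root lattice is a nonzero lattice isometric to an orthogonal direct sum of lattices from the list $\mathbb Z^1$, $\mathbb A_\ell$ ($\ell\ge1$), $\mathbb D_\ell$ ($\ell\ge4$), $\mathbb E_6,\mathbb E_7,\mathbb E_8$, where, with the standard dot product on $\mathbb R^k$: $\mathbb Z^1=\mathbb Z\subset\mathbb R$; $\mathbb A_\ell=\{x\in\mathbb Z^{\ell+1}:\sum x_j=0\}$; $\mathbb D_\ell=\{x\in\mathbb Z^\ell:\sum x_j\equiv0\bmod 2\}$; $\mathbb E_8=\mathbb D_8\cup(\mathbb D_8+\tfrac12(1,\dots,1))$;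 $\mathbb E_7$ is the orthogonal complement in $\mathbb E_8$ of $e_7+e_8$; $\mathbb E_6$ is the orthogonal complement in $\mathbb E_8$ of $e_7+e_8$ and $e_6+e_8$. Equivalently (Witt), a lattice $(L,b)$ is a root lattice iff $b$ is positive-definite and $L$ is generated by $\{x: b(x,x)\in\{1,2\}\}$. *)

(* Defs.v *)
From HB Require Import structures.
From mathcomp Require Import all_boot all_order all_algebra all_field.
From mathcomp Require Import boolp.

Set Implicit Arguments.
Unset Strict Implicit.
Unset Printing Implicit Defensive.

Import Order.TTheory GRing.Theory Num.Theory.
Local Open Scope ring_scope.

(* Values are in rat only so that forms can be restricted from ambient rational
   vector spaces; is_lattice requires them to be integers. *)
Record formModule := FormModule {
  fm_carrier :> zmodType;
  fm_form : fm_carrier -> fm_carrier -> rat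
}.

Definition Zfree_finite_rank (L : zmodType) : Prop :=
  exists (n : nat) (e : 'I_n -> L),
    forall x : L, exists! c : {ffun 'I_n -> int}, x = \sum_(i < n) e i *~ c i.

Definition is_lattice (L : formModule) : Prop :=
  [/\ Zfree_finite_rank L,
      forall x y : L, fm_form x y \is a Num.int,
      forall x y z : L, fm_form (x + y) z = fm_form x z + fm_form y z,
      forall x y : L, fm_form x y = fm_form y x
    & forall x : L, (forall y : L, fm_form x y = 0) -> x = 0].

Definition isometric (L M : formModule) : Prop :=
  exists f : {additive L -> M},
    bijective f /\ forall x y : L, fm_form (f x) (f y) = fm_form x y.

Section Subgroup.
Variables (V : zmodType) (P : zmodClosed V).

Record subgroup := Subgroup { subgroup_val : V; _ : subgroup_val \in P }.

HB.instance Definition _ := [isSub for subgroup_val].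
HB.instance Definition _ := [Choice of subgroup by <:].
HB.instance Definition _ := [SubChoice_isSubZmodule of subgroup by <:].

Definition restrict_form (b : V -> V -> rat) : formModule :=
  @FormModule subgroup (fun x y => b (val x) (val y)).

End Subgroup.

Definition dot n (x y : 'rV[rat]_n) : rat := \sum_(i < n) x 0 i * y 0 i.

Definition Zn_pred n : {pred 'rV[rat]_n} := [pred x | x \is a mxOver Num.int].
Arguments Zn_pred : clear implicits.

Definition An_pred l : {pred 'rV[rat]_l.+1} :=
  [pred x | (x \in Zn_pred l.+1) && (\sum_(j < l.+1) x 0 j == 0)].
Arguments An_pred : clear implicits.

Definition Dn_pred l : {pred 'rV[rat]_l} :=
  [pred x | (x \in Zn_pred l) && ((\sum_(j < l) x 0 j) / 2 \is a Num.int)].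
Arguments Dn_pred : clear implicits.

Definition E8_pred : {pred 'rV[rat]_8} :=
  [pred x | (x \in Dn_pred 8) || (x - const_mx (1 / 2) \in Dn_pred 8)].

(* The standard basis vector e_k, with the 1-based index k. *)
Definition evec (k : nat) : 'rV[rat]_8 := delta_mx 0 (inord k.-1).

Definition E7_pred : {pred 'rV[rat]_8} :=
  [pred x | (x \in E8_pred) && (dot x (evec 7 + evec 8) == 0)].

Definition E6_pred : {pred 'rV[rat]_8} :=
  [pred x | [&& x \in E8_pred, dot x (evec 7 + evec 8) == 0
              & dot x (evec 6 + evec 8) == 0]].

Lemma Zn_zmod_closed n : zmod_closed (Zn_pred n).
Proof.
split=> [|x y]; rewrite ![_ \in Zn_pred n]inE.
  by apply/mxOverP => i j; rewrite mxE rpred0.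
move=> /mxOverP xZ /mxOverP yZ; apply/mxOverP => i j.
by rewrite !mxE; apply: rpredB.
Qed.
HB.instance Definition _ n :=
  GRing.isZmodClosed.Build _ (Zn_pred n) (Zn_zmod_closed n).

Lemma sum_rowB n (x y : 'rV[rat]_n) :
  \sum_(j < n) (x - y) 0 j = \sum_(j < n) x 0 j - \sum_(j < n) y 0 j.
Proof. by rewrite -sumrB; apply: eq_bigr => j _; rewrite !mxE. Qed.

Lemma sum_row0 n : \sum_(j < n) (0 : 'rV[rat]_n) 0 j = 0.
Proof. by rewrite big1 // => j _; rewrite mxE. Qed.

Lemma An_zmod_closed l : zmod_closed (An_pred l).
Proof.
split=> [|x y]; rewrite ![_ \in An_pred l]inE.
  by rewrite rpred0 sum_row0 eqxx.
move=> /andP[xZ /eqP x0] /andP[yZ /eqP y0].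
by rewrite rpredB //= sum_rowB x0 y0 subrr.
Qed.
HB.instance Definition _ l :=
  GRing.isZmodClosed.Build _ (An_pred l) (An_zmod_closed l).

Lemma Dn_zmod_closed l : zmod_closed (Dn_pred l).
Proof.
split=> [|x y]; rewrite ![_ \in Dn_pred l]inE.
  by rewrite rpred0 sum_row0 mul0r rpred0.
move=> /andP[xZ x2] /andP[yZ y2].
by rewrite rpredB //= sum_rowB mulrBl rpredB.
Qed.
HB.instance Definition _ l :=
  GRing.isZmodClosed.Build _ (Dn_pred l) (Dn_zmod_closed l).

Lemma E8_zmod_closed : zmod_closed E8_pred.
Proof.
pose h : 'rV[rat]_8 := const_mx (1 / 2).
have hh : h + h \in Dn_pred 8.
  have -> : h + h = const_mx 1 by apply/rowP => j; rewrite !mxE.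
  rewrite inE; apply/andP; split.
    by rewrite inE; apply/mxOverP => i j; rewrite mxE.
  by under eq_bigr do rewrite mxE; rewrite sumr_const card_ord.
split=> [|x y]; rewrite ![_ \in E8_pred]inE; first by rewrite rpred0.
rewrite -/h => /orP[xD|xD] /orP[yD|yD].
- by rewrite rpredB.
- have -> : x - y - h = x - (y - h) - (h + h).
    by rewrite !opprD !opprK !addrA addrK.
  by rewrite (rpredB (rpredB xD yD) hh) orbT.
- by rewrite addrAC (rpredB xD yD) orbT.
- have -> : x - y = (x - h) - (y - h) by rewrite opprB addrA subrK.
  by rewrite rpredB.
Qed.
HB.instance Definition _ :=
  GRing.isZmodClosed.Build _ E8_pred E8_zmod_closed.

Lemma dot0l n (v : 'rV[rat]_n) : dot 0 v = 0.
Proof. by rewrite /dot big1 // => j _; rewrite mxE mul0r. Qed.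

Lemma dotBl n (x y v : 'rV[rat]_n) : dot (x - y) v = dot x v - dot y v.
Proof.
by rewrite /dot -sumrB; apply: eq_bigr => j _; rewrite !mxE mulrBl.
Qed.

Lemma E7_zmod_closed : zmod_closed E7_pred.
Proof.
split=> [|x y]; rewrite ![_ \in E7_pred]inE; first by rewrite rpred0 dot0l eqxx.
move=> /andP[xE /eqP x1] /andP[yE /eqP y1].
by rewrite rpredB //= dotBl x1 y1 subrr.
Qed.
HB.instance Definition _ :=
  GRing.isZmodClosed.Build _ E7_pred E7_zmod_closed.

Lemma E6_zmod_closed : zmod_closed E6_pred.
Proof.
split=> [|x y]; rewrite ![_ \in E6_pred]inE.
  by rewrite rpred0 !dot0l eqxx.
move=> /and3P[xE /eqP x1 /eqP x2] /and3P[yE /eqP y1 /eqP y2].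
by rewrite rpredB //= !dotBl x1 y1 x2 y2 subrr eqxx.
Qed.
HB.instance Definition _ :=
  GRing.isZmodClosed.Build _ E6_pred E6_zmod_closed.

Inductive root_type := TypeZ | TypeA of nat | TypeD of nat
  | TypeE6 | TypeE7 | TypeE8.

Definition valid_root_type (t : root_type) : bool :=
  match t with
  | TypeA l => (1 <= l)%N
  | TypeD l => (4 <= l)%N
  | _ => true
  end.

Definition basic_lattice (t : root_type) : formModule :=
  match t with
  | TypeZ => restrict_form (Zn_pred 1) (@dot 1)
  | TypeA l => restrict_form (An_pred l) (@dot l.+1)
  | TypeD l => restrict_form (Dn_pred l) (@dot l)
  | TypeE6 => restrict_form E6_pred (@dot 8)
  | TypeE7 => restrict_form E7_pred (@dot 8)
  | TypeE8 => restrict_form E8_pred (@dot 8)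
  end.

Definition zero_lattice : formModule :=
  @FormModule 'rV[rat]_0 (fun _ _ => 0).

Definition orth_sum (L M : formModule) : formModule :=
  @FormModule (L * M)%type
    (fun x y => fm_form x.1 y.1 + fm_form x.2 y.2).

Definition root_sum (ts : seq root_type) : formModule :=
  foldr (fun t L => orth_sum (basic_lattice t) L) zero_lattice ts.

Definition is_root_lattice (L : formModule) : Prop :=
  [/\ is_lattice L,
      exists x : L, x != 0
    & exists2 ts : seq root_type,
        all valid_root_type ts & isometric L (root_sum ts)].

Section NumberField.
Variable K : fieldExtType rat.

Definition is_integral (x : K) : Prop := integralOver (intr : int -> K) x.

Definition ringO_pred : {pred K} := [pred x | `[< is_integral x >]].

Lemma ringO_zmod_closed : zmod_closed ringO_pred.
Proof.
split=> [|x y]; rewrite !inE; first by apply/asboolP; exact: integral0.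
by move=> /asboolP xO /asboolP yO; apply/asboolP; exact: integral_sub.
Qed.
HB.instance Definition _ :=
  GRing.isZmodClosed.Build _ ringO_pred ringO_zmod_closed.

Definition fieldTrace (x : K) : rat :=
  \tr (passmx.mxof (vbasis {:K}) (vbasis {:K}) (amulr x)).

Definition trace_form (theta : K -> K) (x y : K) : rat :=
  fieldTrace (x * theta y).

Definition ringO_lattice (theta : K -> K) : formModule :=
  restrict_form ringO_pred (trace_form theta).

(* K = Q(sqrt d), for an abstract K: K is generated over Q by a square root of d. *)
Definition is_Q_sqrt (d : int) : Prop :=
  exists2 s : K, s ^+ 2 = d%:~R & <<1; s>>%VS = {:K}%VS.

(* theta is induced by complex conjugation through an embedding in algC; for the
   imaginary quadratic fields considered here the choice of iota is immaterial. *)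
Definition is_complex_conj (theta : K -> K) : Prop :=
  exists iota : {rmorphism K -> algC}, forall x, iota (theta x) = (iota x)^*.

End NumberField.

(* Main.v *)
(** Restricted to [O], a positive definite trace form satisfies
    [Tr (x * theta x) >= n = [K : Q]] for [x != 0]: multiplication by
    [a = x * theta x] is self-adjoint and positive for the form, so its
    eigenvalues are positive algebraic integers of integral product [>= 1], and
    AM-GM bounds their sum by [n] from below, with equality only for [a = 1].
    A root lattice contains a vector of norm 1 or 2, hence [n <= 2]. If [n = 2],
    a root [x] outside [Q] satisfies [x * theta x = 1], and positivity forces the
    integer [x + theta x] to be [-1], [0] or [1], so [K] is generated by
    [sqrt (-3)] or [sqrt (-1)]. Conversely the three forms are those of [Z^1],
    [A_2] and [A_1 + A_1]. *)

Require Import Defs.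
From HB Require Import structures.
From mathcomp Require Import all_boot all_order all_algebra all_field.
From mathcomp Require Import boolp ring lra zify.
Import Order.TTheory GRing.Theory Num.Theory passmx.
Set Implicit Arguments.
Unset Strict Implicit.
Unset Printing Implicit Defensive.
Local Open Scope ring_scope.

(** * Positive definite rational matrices *)

Set Implicit Arguments.
Unset Strict Implicit.
Unset Printing Implicit Defensive.

(** Root lattices are given by an explicit list, so the forward direction extracts two facts from
    it: positivity, and a dichotomy on vectors of norm at most 2. Either one such vector generates
    the lattice, and then [K] is the rational field, or there are two of them that differ even up to
    sign. A single short vector says nothing when [[K : Q] = 2], because 1 itself then has norm 2.
    But a rational [x] with [x * theta x = 1] is 1 or -1, so of two short vectors distinct up to
    sign one is irrational. The eigenvalue argument needs a Gram matrix for a rational basis of [K],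
    whereas the lattice only gives information on integers of [K]; clearing denominators links the
    two. The eigenvectors live over [algC], hence positivity has to be carried from rational to
    complex vectors. *)

Definition posdef n (G : 'M[rat]_n) :=
  G^T = G /\ forall u : 'rV_n, u != 0 -> 0 < (u *m G *m u^T) 0 0.

Local Notation "A ^r" := (map_mx ratr A) (at level 1, format "A ^r").
Local Notation "v ^h" := (map_mx Num.conj v^T) (at level 1, format "v ^h").

(* Completing the square over [rat]; the same factorization then diagonalizes the
   Hermitian extension of [G], which density of the rationals alone would only
   show to be semidefinite. *)
Lemma posdef_schur n (G : 'M[rat]_(1 + n)) : posdef G ->
  exists (g : rat) (c : 'cV[rat]_n) (S : 'M[rat]_n),
    [/\ 0 < g, posdef S
      & G = block_mx 1 0 c 1%:M *m block_mx g%:M 0 0 S *m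
            (block_mx 1 0 c 1%:M)^T].
Proof.
move=> [Gsym Gpos].
pose g := G 0 0; pose u := ursubmx G; pose G' := drsubmx G.
have ul : ulsubmx G = g%:M.
  by apply/matrixP => i j; rewrite !mxE !ord1 mulr1n; congr (G _ _); apply/val_inj.
have dl : dlsubmx G = u^T by rewrite /u trmx_ursub Gsym.
have G's : G'^T = G' by rewrite /G' trmx_drsub Gsym.
have defG : G = block_mx g%:M u u^T G' by rewrite -ul -dl submxK.
have g0 : 0 < g.
  have := Gpos (delta_mx 0 0).
  rewrite -rowE trmx_delta -colE !mxE; apply.
  by apply/eqP => /matrixP/(_ 0 0); rewrite !mxE !eqxx.
have gu : g \is a GRing.unit by rewrite unitfE gt_eqF.
pose c := g^-1 *: u^T; pose S := G' - g^-1 *: (u^T *m u).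
have facG : G = block_mx 1 0 c 1%:M *m block_mx g%:M 0 0 S *m
            (block_mx 1 0 c 1%:M)^T.
  rewrite tr_block_mx !trmx1 !trmx0 !mulmx_block.
  rewrite !mulmx0 !mul0mx !mulmx1 !mul1mx
    ?addr0 ?add0r ?mulmx0 ?mul0mx ?addr0 ?add0r defG.
  have cg : c *m g%:M = u^T by rewrite mul_mx_scalar scalerA mulrV // scale1r.
  have gc : g%:M *m c^T = u by rewrite -[u]trmxK -cg trmx_mul tr_scalar_mx.
  by rewrite cg gc /S {1}/c linearZ /= trmxK -scalemxAr addrC subrK.
exists g, c, S; split => //; split.
  by rewrite /S linearB linearZ /= trmx_mul trmxK G's.
move=> w w0.
(* This [z] is the vector that the unipotent factor sends to [(0, w)], so the form of [G] at [z] is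
   the form of [S] at [w]. *)
pose z := row_mx (- (w *m c)) w.
have zL : z *m block_mx 1 0 c 1%:M = row_mx 0 w.
  by rewrite mul_row_block !mulmx1 mulmx0 add0r addNr.
have z0 : z != 0.
  by apply: contraNneq w0 => /(congr1 rsubmx); rewrite row_mxKr linear0 => ->.
have := Gpos z z0.
rewrite {1}facG !mulmxA zL -mulmxA -trmx_mul zL mul_row_block tr_row_mx.
by rewrite mul_row_col !mulmx0 !mul0mx !add0r trmx0 mulmx0 add0r.
Qed.

(** Induction on the size: after the change of variables [w = v L] the Hermitian form is [g |w_0|^2]
    plus the form of the smaller matrix [S]. The same [L] serves for transpose and for conjugate
    transpose, its entries being rational. *)
Lemma posdef_closed (C : numClosedFieldType) n (G : 'M[rat]_n) (v : 'rV[C]_n) :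
  posdef G -> v != 0 -> 0 < (v *m G^r *m v^h) 0 0.
Proof.
elim: n G v => [|n IHn] G v.
  by move=> _ /eqP[]; apply/rowP => -[].
rewrite -[n.+1]/(1 + n)%N in G v *.
move=> /posdef_schur[g [c [S [g0 Spos ->]]]] v0.
pose L := block_mx 1 0 c 1%:M : 'M[rat]_(1 + n).
pose w := v *m L^r.
have Lr : L^T^r = L^r^h :> 'M[C]_(1 + n).
  by apply/matrixP => i j; rewrite !mxE fmorph_rat.
have -> : v *m (L *m block_mx g%:M 0 0 S *m L^T)^r *m v^h =
          w *m (block_mx g%:M 0 0 S)^r *m w^h.
  rewrite !map_mxM !mulmxA -/w -!mulmxA; congr (_ *m (_ *m _)).
  by rewrite Lr -map_mxM -trmx_mul.
have w0 : w != 0.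
  apply: contraNneq v0 => w0.
  (* The second block matrix is the inverse of [L]. *)
  have : v *m (L *m block_mx 1 0 (- c) 1%:M)^r = 0.
    by rewrite map_mxM mulmxA -/w w0 mul0mx.
  rewrite /L mulmx_block !mulmx1 !mul1mx !mulmx0 !mul0mx !addr0 subrr !add0r.
  by rewrite -[block_mx _ _ _ _]scalar_mx_block map_mx1 mulmx1 => ->.
rewrite -[w]hsubmxK map_block_mx !map_mx0 mul_row_block.
rewrite !mulmx0 addr0 add0r.
rewrite tr_row_mx map_col_mx mul_row_col mxE.
have lterm : (lsubmx w *m (g%:M)^r *m (lsubmx w)^h) 0 0 =
             ratr g * `|lsubmx w 0 0| ^+ 2.
  by rewrite map_scalar_mx mul_mx_scalar -scalemxAl !mxE big_ord1 !mxE normCK.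
rewrite lterm.
have lt0g : 0 < (ratr g : C) by rewrite ltr0q.
have [r0|r0] := eqVneq (rsubmx w) 0; last first.
  rewrite ltr_wpDl // ?IHn //.
  by rewrite mulr_ge0 ?exprn_ge0 // ltW.
rewrite r0 !mul0mx [X in _ + X]mxE addr0 pmulr_rgt0 // exprn_gt0 // normr_gt0.
apply: contraNneq w0 => l0; rewrite -[w]hsubmxK r0.
have -> : lsubmx w = 0 by apply/matrixP => i j; rewrite !ord1 l0 mxE.
by rewrite row_mx0.
Qed.

(** Positivity of [M *m G] makes [M] self-adjoint and positive for [G]: if [v M = x v], then
    [v M G v^h = x (v G v^h)], so [x] is a quotient of two positive numbers. In the equality case an
    eigenvalue 1 is all that is concluded; for a multiplication matrix of a field this already
    determines the element. *)
Lemma trace_posdef_ge n (M G : 'M[rat]_n) :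
    posdef G -> posdef (M *m G) ->
    (forall x : algC, eigenvalue M^r x -> x \in Aint) ->
  (0 < n)%N -> n%:R <= \tr M /\ (\tr M = n%:R -> eigenvalue M 1).
Proof.
move=> Gpos MGpos eigA n_gt0.
pose N : 'M[algC]_n := M^r.
have [s Es] := closed_field_poly_normal (char_poly N).
rewrite (monicP (char_poly_monic N)) scale1r in Es.
have ss : size s = n.
  by apply/succn_inj; rewrite -(size_prod_XsubC s id) -Es size_char_poly.
have tM : ratr (\tr M) = \sum_(x <- s) x.
  have := char_poly_trace N n_gt0.
  rewrite Es -{1}ss coefPn_prod_XsubC ?ss -?lt0n // => /oppr_inj ->.
  by rewrite trace_map_mx.
have dM : ratr (\det M) = \prod_(x <- s) x.
  have := char_poly_det N.
  rewrite Es coef0_prod_XsubC ss det_map_mx => /mulfI dE.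
  by rewrite dE ?signr_eq0.
have eigs x : x \in s -> eigenvalue N x.
  by move=> xs; rewrite eigenvalue_root_char Es root_prod_XsubC.
have pos_s x : x \in s -> 0 < x.
  move=> /eigs/eigenvalueP[v vM v0].
  have vG := posdef_closed Gpos v0; have := posdef_closed MGpos v0.
  by rewrite map_mxM mulmxA vM -!scalemxAl [X in 0 < X]mxE pmulr_lgt0.
(* The product is the determinant of [M]: rational, an algebraic integer and positive, hence a
   positive integer. *)
have d1 : 1 <= \prod_(x <- s) x.
  have dA : \prod_(x <- s) x \in Aint by rewrite big_seq rpred_prod // => x /eigs/eigA.
  have dZ : \prod_(x <- s) x \is a Num.int by rewrite Cint_rat_Aint // -dM Crat_rat.
  have d0 : 0 < \prod_(x <- s) x by rewrite big_seq prodr_gt0.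
  have /natrP[k Ek] : \prod_(x <- s) x \is a Num.nat by rewrite natrEint dZ ltW.
  by rewrite Ek ler1n -(ltr0n algC) -Ek.
have ge0_s : {in predT, forall i : 'I_n, 0 <= s`_i}.
  by move=> i _; rewrite ltW // pos_s // mem_nth // ss.
have sumE : \sum_(x <- s) x = \sum_(i < n) s`_i by rewrite (big_nth 0) big_mkord ss.
have prodE : \prod_(x <- s) x = \prod_(i < n) s`_i by rewrite (big_nth 0) big_mkord ss.
have := leif_AGM ge0_s; rewrite /= card_ord -sumE -prodE -tM => -[AG AGeq].
have n0 : 0 < n%:R :> rat by rewrite ltr0n.
have muE : ratr (\tr M) / n%:R = ratr (\tr M / n%:R) :> algC.
  by rewrite fmorph_div /= ratr_nat.
have tr_ge0 : 0 <= \tr M.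
  by rewrite -(ler0q algC) tM big_seq sumr_ge0 // => x /pos_s/ltW.
split.
  have : 1 <= (ratr (\tr M) / n%:R) ^+ n :> algC by apply: le_trans AG.
  rewrite muE expr_ge1 // ?ler0q ?divr_ge0 // ?ler0n //.
  by rewrite -[1](rmorph1 ratr) ler_rat ler_pdivlMr // mul1r.
move=> trn; move: AG AGeq.
rewrite muE trn divff ?lt0r_neq0 // rmorph1 expr1n => AG.
(* With mean 1 the inequality gives product at most 1, so equality holds and all eigenvalues
   coincide. *)
have -> : \prod_(x <- s) x == 1 by rewrite eq_le AG d1.
move=> /esym/forallP eq_s.
have s0 (i : 'I_n) : s`_i = s`_0.
  by have /forallP/(_ (Ordinal n_gt0))/eqP := eq_s i.
have : ratr (\tr M) = s`_0 *+ n.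
  by rewrite tM sumE (eq_bigr (fun=> s`_0)) // sumr_const card_ord.
rewrite trn ratr_nat => /(pmulrnI n_gt0) s01.
have : eigenvalue N 1 by apply: eigs; rewrite s01 mem_nth // ss.
(* The value 1 is rational, so being a root of the characteristic polynomial descends from [algC] to
   [rat]. *)
rewrite !eigenvalue_root_char -map_char_poly /root.
by rewrite -[1](rmorph1 ratr) horner_map fmorph_eq0.
Qed.

(** * The trace and integral elements of a number field *)

Section FieldTrace.
Variable K : fieldExtType rat.
Implicit Types (x y z : K) (q : rat).

Local Notation n := (\dim {:K}).
Local Notation e := (vbasis {:K}).

Definition mulmat x : 'M[rat]_n := mxof e e (amulr x).

Lemma mulmatP q x y : mulmat (q *: x + y) = q *: mulmat x + mulmat y.
Proof.
apply/row_matrixP => i; rewrite !rowE mulmxDr -scalemxAr !mul_mxof.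
by rewrite !lfunE /= mulrDr -scalerAr linearP.
Qed.

Lemma mulmat0 : mulmat 0 = 0.
Proof.
apply: (addIr (mulmat 0)).
by rewrite -{2}[mulmat 0]scale1r addrC -mulmatP scaler0 !add0r.
Qed.

Lemma mulmatM x y : mulmat (x * y) = mulmat x *m mulmat y.
Proof.
rewrite /mulmat -mxof_comp ?vbasisP //; congr mxof.
by apply/lfunP => z; rewrite comp_lfunE !lfunE /= mulrA.
Qed.

Lemma mulmat1 : mulmat 1 = 1%:M.
Proof.
apply/row_matrixP => i; rewrite !rowE mul_mxof lfunE /= mulr1 mulmx1.
by rewrite vecofK ?vbasisP.
Qed.

Lemma fieldTraceP q x y : fieldTrace (q *: x + y) = q * fieldTrace x + fieldTrace y.
Proof. by rewrite /fieldTrace -![mxof _ _ _]/(mulmat _) mulmatP linearP. Qed.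

Lemma fieldTraceD x y : fieldTrace (x + y) = fieldTrace x + fieldTrace y.
Proof. by rewrite -[x]scale1r fieldTraceP scale1r mul1r. Qed.

Lemma fieldTrace0 : fieldTrace (0 : K) = 0.
Proof. by apply: (addrI (fieldTrace (0 : K))); rewrite -fieldTraceD !addr0. Qed.

Lemma fieldTraceZ q x : fieldTrace (q *: x) = q * fieldTrace x.
Proof. by rewrite -[q *: x]addr0 fieldTraceP fieldTrace0 addr0. Qed.

Lemma fieldTrace1 : fieldTrace (1 : K) = n%:R.
Proof. by rewrite -mxtrace1 -mulmat1. Qed.

Lemma fieldTrace_sum I (r : seq I) (F : I -> K) :
  fieldTrace (\sum_(i <- r) F i) = \sum_(i <- r) fieldTrace (F i).
Proof. by rewrite (big_morph _ fieldTraceD fieldTrace0). Qed.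

(** A rational eigenvector is a nonzero element [y] of [K] with [y x = y], and [y] cancels. *)
Lemma eigenvalue_mulmat1 x : eigenvalue (mulmat x) 1 -> x = 1.
Proof.
move=> /eigenvalueP[v]; rewrite scale1r mul_mxof lfunE /= => vx v0.
have := congr1 (vecof e) vx; rewrite rVofK ?vbasisP // => /eqP.
rewrite -subr_eq0 -{2}[vecof _ v]mulr1 -mulrBr mulf_eq0.
by rewrite vecof_eq0 ?vbasisP // (negPf v0) subr_eq0 => /eqP.
Qed.

Lemma eigenvalue_mulmat_horner (p : {poly rat}) x (v : 'rV[algC]_n) a :
    v *m map_mx ratr (mulmat x) = a *: v ->
  v *m map_mx ratr (mulmat (map_poly (in_alg K) p).[x]) =
    (map_poly ratr p).[a] *: v.
Proof.
move=> vx; elim/poly_ind: p => [|p c IHp].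
  by rewrite !rmorph0 !horner0 scale0r mulmat0 map_mx0 mulmx0.
rewrite !rmorphD !rmorphM /= !map_polyX !map_polyC /= !hornerE addrC
  mulmatP mulmat1 mulmatM.
rewrite map_mxD map_mxM map_mxZ map_mx1 mulmxDr mulmxA IHp -scalemxAl vx.
by rewrite -scalemxAr mulmx1 scalerA -scalerDl addrC.
Qed.

(** A monic integer polynomial [p] vanishing at [x] also vanishes on the matrix of [x]; applied to a
    complex eigenvector this reads [0 = p(a) v]. *)
Lemma eigenvalue_mulmat_Aint x (a : algC) :
  is_integral x -> eigenvalue (map_mx ratr (mulmat x)) a -> a \in Aint.
Proof.
move=> [p p_mon px] /eigenvalueP[v vx v0].
have := eigenvalue_mulmat_horner (map_poly intr p) vx.
rewrite -map_poly_comp /=.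
have -> : map_poly (in_alg K \o intr) p = map_poly intr p.
  by apply: eq_map_poly => i /=; rewrite alg_num_field ratr_int.
rewrite (rootP px).
rewrite mulmat0 map_mx0 mulmx0 -map_poly_comp => /esym/eqP.
have -> : map_poly (ratr \o intr) p = map_poly intr p :> {poly algC}.
  by apply: eq_map_poly => i /=; rewrite ratr_int.
rewrite scaler_eq0 (negPf v0) orbF => pa.
apply: (root_monic_Aint (p := map_poly intr p)) => //.
  exact: monic_map.
by apply/polyOverP => i; rewrite coef_map /= intr_int.
Qed.

Lemma integral_rat q : is_integral (q%:A : K) -> q \is a Num.int.
Proof.
move=> [p p_mon].
have -> : map_poly intr p = map_poly (in_alg K) (map_poly intr p).
  by rewrite -map_poly_comp; apply: eq_map_poly => i /=; rewrite alg_num_field ratr_int.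
rewrite (fmorph_root (in_alg K)) => pq.
rewrite -Cint_rat; apply: Cint_rat_Aint; first exact: Crat_rat.
apply: (root_monic_Aint (p := map_poly ratr (map_poly intr p))).
- by rewrite fmorph_root.
- by rewrite map_monic; apply: monic_map.
by apply/polyOverP => i; rewrite !coef_map /= ratr_int intr_int.
Qed.

Lemma integral_int (m : int) : is_integral (m%:~R : K).
Proof. exact: (integral_id (intr : int -> K)). Qed.

(** If [a] is a common denominator of the coefficients [q_i] of the minimal polynomial of [z], of
    degree [d], then [a z] is a root of the monic polynomial with coefficients [q_i a^(d - i)],
    which are integers. *)
Lemma integral_multiple z :
  exists2 m : int, m != 0 & is_integral (m%:~R * z).
Proof.
have /polyOver1P[q Eq] := minPolyOver 1%AS z.
have q_mon : q \is monic by rewrite -(map_monic (in_alg K)) -Eq monic_minPoly.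
have qz : root (map_poly (in_alg K) q) z by rewrite -Eq root_minPoly.
have [r [a a0 Er]] := rat_poly_scale q.
exists a => //.
pose d := (size q).-1.
have sq : size q = d.+1 by rewrite prednK // size_poly_gt0 monic_neq0.
have qd : q`_d = 1 by apply/monicP.
pose g := \poly_(i < d.+1) (q`_i * a%:~R ^+ (d - i)).
have sg : size g = d.+1.
  by apply: size_poly_eq; rewrite subnn mulr1 qd oner_neq0.
have g_mon : g \is monic.
  by rewrite monicE lead_coefE sg coef_poly ltnSn subnn mulr1 qd.
have gZ i : g`_i \is a Num.int.
  rewrite coef_poly; case: ltnP => // id; have [->|neq_id] := eqVneq i d.
    by rewrite subnn mulr1 qd.
  (* For [i < d] at least one factor [a] is available, and it clears the denominator of [q_i]. *)
  have -> : (d - i = (d - i).-1.+1)%N by lia.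
  have -> : q`_i * a%:~R ^+ (d - i).-1.+1 = (r`_i)%:~R * a%:~R ^+ (d - i).-1.
    by rewrite exprS mulrA {1}Er coefZ coef_map /= [_^-1 * _]mulrC divfK ?intr_eq0.
  by rewrite rpredM ?rpredX ?intr_int.
apply: (integral_root_monic (p := map_poly (in_alg K) g)).
- by rewrite map_monic.
- apply/rootP; rewrite (@horner_coef_wide _ d.+1) ?size_map_poly ?sg //.
  have := rootP qz; rewrite (@horner_coef_wide _ d.+1) ?size_map_poly ?sq // => qz0.
  apply: etrans
    (_ : a%:~R ^+ d * \sum_(i < d.+1) (map_poly (in_alg K) q)`_i * z ^+ i = 0);
    last by rewrite qz0 mulr0.
  rewrite mulr_sumr; apply: eq_bigr => i _.
  rewrite !coef_map coef_poly ltn_ord /= -![_ *: 1]/(in_alg K _) rmorphM rmorphXn /=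
    (alg_num_field _ a%:~R) ratr_int exprMn.
  have -> : a%:~R ^+ d = a%:~R ^+ (d - i) * a%:~R ^+ i :> K.
    by rewrite -exprD subnK // -ltnS.
  by rewrite -!mulrA; ring.
apply/integral_poly => i; rewrite coef_map /=.
have /intrP[k ->] := gZ i.
by rewrite alg_num_field ratr_int; apply: integral_int.
Qed.

End FieldTrace.

(** * The trace form *)

Section TraceForm.
Variables (K : fieldExtType rat) (theta : {rmorphism K -> K}).
Implicit Types (x y z : K) (q : rat).

Local Notation n := (\dim {:K}).
Local Notation e := (vbasis {:K}).
Local Notation form := (trace_form theta).

Lemma formZl q x y : form (q *: x) y = q * form x y.
Proof. by rewrite /trace_form -scalerAl fieldTraceZ. Qed.

Lemma formZr q x y : form x (q *: y) = q * form x y.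
Proof. by rewrite /trace_form fmorph_numZ -scalerAr fieldTraceZ. Qed.

Lemma form_suml I (r : seq I) (F : I -> K) y :
  form (\sum_(i <- r) F i) y = \sum_(i <- r) form (F i) y.
Proof. by rewrite /trace_form mulr_suml fieldTrace_sum. Qed.

Lemma form_sumr I (r : seq I) (F : I -> K) x :
  form x (\sum_(i <- r) F i) = \sum_(i <- r) form x (F i).
Proof. by rewrite /trace_form rmorph_sum mulr_sumr fieldTrace_sum. Qed.

Lemma integral_theta x : is_integral x -> is_integral (theta x).
Proof.
move=> [p p_mon px]; exists p => //.
have -> : map_poly intr p = map_poly theta (map_poly intr p).
  by rewrite -map_poly_comp; apply: eq_map_poly => i /=; rewrite rmorph_int.
by rewrite fmorph_root.
Qed.

Hypothesis theta_inv : forall x, theta (theta x) = x.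
Hypothesis form_sym : forall x y, form x y = form y x.
Hypothesis form_pos : forall x, x != 0 -> 0 < form x x.

(** The Gram matrix of the basis multiplied by [x]; at [x = 1] it is the Gram matrix of the form
    itself. *)
Definition scaled_gram x : 'M[rat]_n := \matrix_(i, j) form (e`_i * x) (e`_j * x).

Lemma scaled_gram_posdef x : x != 0 -> posdef (scaled_gram x).
Proof.
move=> x0; split=> [|u u0]; first by apply/matrixP => i j; rewrite !mxE form_sym.
have -> : (u *m scaled_gram x *m u^T) 0 0 = form (vecof e u * x) (vecof e u * x).
  rewrite /vecof mulr_suml form_sumr mxE; apply: eq_bigr => j _.
  rewrite !mxE form_suml mulr_suml; apply: eq_bigr => i _.
  by rewrite !mxE -!scalerAl formZl formZr; ring.
by rewrite form_pos // mulf_neq0 // vecof_eq0 // vbasisP.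
Qed.

(** Both sides rest on [Tr (y x theta(x) theta(z))], read as the form at [(y x theta(x), z)] or at
    [(y x, z x)]. The product matrix is thus visibly positive definite. *)
Lemma mulmat_gram x : mulmat (x * theta x) *m scaled_gram 1 = scaled_gram x.
Proof.
apply/matrixP => i j; rewrite !mxE.
transitivity (form (vecof e (row i (mulmat (x * theta x)))) e`_j).
  rewrite /vecof form_suml; apply: eq_bigr => k _.
  by rewrite !mxE !mulr1 formZl.
rewrite rowE mul_mxof lfunE /= rVofK ?vbasisP // vecof_delta.
by rewrite /trace_form rmorphM; congr fieldTrace; ring.
Qed.

Lemma trace_form_integral_ge x : is_integral x -> x != 0 ->
  n%:R <= form x x /\ (form x x = n%:R -> x * theta x = 1).
Proof.
move=> xO x0.
have aO : is_integral (x * theta x) by apply: integral_mul => //; apply: integral_theta.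
have MG : posdef (mulmat (x * theta x) *m scaled_gram 1).
  by rewrite mulmat_gram; apply: scaled_gram_posdef.
have [] := trace_posdef_ge (scaled_gram_posdef (oner_neq0 _)) MG _ _.
- by move=> a; apply: eigenvalue_mulmat_Aint.
- by rewrite adim_gt0.
by move=> ge1 eq1; split => // /eq1/eigenvalue_mulmat1.
Qed.

End TraceForm.

(** Symmetry and positivity are homogeneous in each argument, and every element of [K] has a nonzero
    integer multiple that is integral. *)
Lemma trace_form_extend (K : fieldExtType rat) (theta : {rmorphism K -> K}) :
    (forall x y : K, is_integral x -> is_integral y ->
       trace_form theta x y = trace_form theta y x) ->
    (forall x : K, is_integral x -> x != 0 -> 0 < trace_form theta x x) ->
  (forall x y : K, trace_form theta x y = trace_form theta y x) /\
  (forall x : K, x != 0 -> 0 < trace_form theta x x).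
Proof.
move=> fsym fpos.
have aZ (a : int) (x : K) : a%:~R * x = a%:~R *: x by rewrite mulrzl scaler_int.
split=> [x y|x x0].
  have [a a0 ax] := integral_multiple x; have [b b0 b_y] := integral_multiple y.
  have := fsym _ _ ax b_y; rewrite !aZ !formZl !formZr.
  by rewrite [RHS]mulrCA => /mulfI; rewrite intr_eq0 => /(_ a0)/mulfI;
    rewrite intr_eq0; apply.
have [a a0 ax] := integral_multiple x.
have := fpos _ ax; rewrite aZ formZl formZr mulrA -expr2 scaler_eq0 intr_eq0.
rewrite negb_or a0 x0 => /(_ isT); rewrite pmulr_rgt0 //.
by rewrite exprn_even_gt0 //= intr_eq0.
Qed.

(** * Short vectors in root lattices *)

Lemma dotC n (x y : 'rV[rat]_n) : dot x y = dot y x.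
Proof. by apply: eq_bigr => i _; rewrite mulrC. Qed.

Lemma dotDl n (x y v : 'rV[rat]_n) : dot (x + y) v = dot x v + dot y v.
Proof. by rewrite /dot -big_split; apply: eq_bigr => i _; rewrite mxE mulrDl. Qed.

Lemma dotNl n (x v : 'rV[rat]_n) : dot (- x) v = - dot x v.
Proof. by rewrite -sub0r dotBl dot0l sub0r. Qed.

Lemma dot_delta n (i : 'I_n) (v : 'rV[rat]_n) : dot (delta_mx 0 i) v = v 0 i.
Proof.
rewrite /dot (bigD1 i) //= mxE !eqxx mul1r big1 ?addr0 // => j ji.
by rewrite mxE (negPf ji) andbF mul0r.
Qed.

Lemma dot_gt0 n (x : 'rV[rat]_n) : x != 0 -> 0 < dot x x.
Proof.
move=> x0; have [i xi0] : exists i, x 0 i != 0.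
  by apply/existsP; apply: contraNT x0 => /existsPn x0; apply/eqP/rowP => i;
    rewrite mxE; apply/eqP; have := x0 i; rewrite negbK.
rewrite /dot (bigD1 i) //= ltr_pwDl //.
  by rewrite -expr2 exprn_even_gt0.
by apply: sumr_ge0 => j _; rewrite -expr2 sqr_ge0.
Qed.

Lemma restrict_form_gt0 n (P : zmodClosed 'rV[rat]_n)
    (x : restrict_form P (@dot n)) : x != 0 -> 0 < fm_form x x.
Proof.
by move=> x0; apply: dot_gt0; apply: contraNneq x0 => x0; apply/eqP/val_inj.
Qed.

Lemma basic_lattice_gt0 t (x : basic_lattice t) : x != 0 -> 0 < fm_form x x.
Proof. by case: t x => [|l|l|||] x; exact: restrict_form_gt0. Qed.

Lemma basic_lattice_0 t : fm_form (0 : basic_lattice t) 0 = 0.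
Proof. by case: t => [|l|l|||]; exact: dot0l. Qed.

Lemma root_sum_0 ts : fm_form (0 : root_sum ts) 0 = 0.
Proof. by elim: ts => [//|t ts IH]; rewrite /= IH basic_lattice_0. Qed.

Lemma root_sum_gt0 ts (x : root_sum ts) : x != 0 -> 0 < fm_form x x.
Proof.
elim: ts x => [|t ts IH] /=; first by move=> x /eqP[]; apply/rowP => -[].
move=> [x y]; rewrite xpair_eqE negb_and /=.
have [->|x0] := eqVneq x 0; have [->|y0] := eqVneq y 0 => //= _.
- by rewrite basic_lattice_0 add0r IH.
- by rewrite root_sum_0 addr0 basic_lattice_gt0.
by rewrite addr_gt0 ?IH ?basic_lattice_gt0.
Qed.

Definition short (L : formModule) (x : L) := x != 0 /\ fm_form x x <= 2.

Definition short_cyclic (L : formModule) :=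
  exists2 e : L, short e & forall x : L, exists k : int, x = e *~ k.

Definition short_pair (L : formModule) :=
  exists x y : L, [/\ short x, short y, x <> y & x <> - y].

(** If [w] were [u] or [-u], the product of [u] and [w] would be 2 or -2. *)
Lemma short_pair_restrict n (P : zmodClosed 'rV[rat]_n) (u w : 'rV[rat]_n) :
    u \in P -> w \in P -> dot u u = 2 -> dot w w = 2 ->
    dot u w \in [:: 0; 1] ->
  short_pair (restrict_form P (@dot n)).
Proof.
move=> uP wP uu ww uw.
exists (Subgroup uP), (Subgroup wP); split.
- split; last by rewrite /= uu.
  by apply/eqP => /(congr1 val) /= u0; move: uu; rewrite u0 dot0l.
- split; last by rewrite /= ww.
  by apply/eqP => /(congr1 val) /= u0; move: ww; rewrite u0 dot0l.
- by move=> /(congr1 val) /= E; move: uw; rewrite E ww.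
- by move=> /(congr1 val) /= E; move: uw; rewrite E dotNl ww.
Qed.

Lemma delta_Zn n (i : 'I_n) : delta_mx 0 i \in Zn_pred n.
Proof. by rewrite inE; apply/mxOverP => k j; rewrite mxE; case: (_ && _). Qed.

Lemma sum_delta n (i : 'I_n) : \sum_j (delta_mx 0 i : 'rV[rat]_n) 0 j = 1.
Proof.
rewrite (bigD1 i) //= mxE !eqxx big1 ?addr0 // => j ji.
by rewrite mxE (negPf ji) andbF.
Qed.

Lemma delta_Dn n (i j : 'I_n) :
  delta_mx 0 i + delta_mx 0 j \in Dn_pred n /\
  delta_mx 0 i - delta_mx 0 j \in Dn_pred n.
Proof.
split.
  rewrite inE rpredD ?delta_Zn //=.
  have -> : \sum_k (delta_mx 0 i + delta_mx 0 j : 'rV[rat]_n) 0 k = 2.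
    by under eq_bigr do rewrite mxE; rewrite big_split /= !sum_delta.
  by rewrite divff.
by rewrite inE rpredB ?delta_Zn //= sum_rowB !sum_delta subrr mul0r.
Qed.

Lemma delta_An n (i j : 'I_n.+1) : delta_mx 0 i - delta_mx 0 j \in An_pred n.
Proof. by rewrite inE rpredB ?delta_Zn //= sum_rowB !sum_delta subrr. Qed.

(** The cyclic cases are [Z^1] and [A_1]. For larger [A_l] the roots [e_1 - e_2] and [e_1 - e_3]
    have product 1; the types D and E contain the orthogonal roots [e_1 + e_2] and [e_1 - e_2]. *)
Lemma basic_lattice_short t : valid_root_type t ->
  short_cyclic (basic_lattice t) \/ short_pair (basic_lattice t).
Proof.
have i01 n : (ord0 : 'I_n.+2) == lift ord0 ord0 = false by [].
case: t => [|l|l|||] /=.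
- move=> _; left.
  have oP : const_mx 1 \in Zn_pred 1 by rewrite inE; apply/mxOverP => i j; rewrite mxE.
  exists (Subgroup oP).
    split; last by rewrite /= /dot big_ord1 !mxE.
    by apply/eqP => /(congr1 val)/matrixP/(_ 0 0); rewrite !mxE.
  move=> x; have /mxOverP/(_ 0 0)/intrP[k Ek] := valP x.
  exists k; apply: val_inj; apply/rowP => i.
  by rewrite ord1 Ek raddfMz /= -scaler_int !mxE mulr1.
- case: l => [|[|l]] // _; [left|right].
    have eP := delta_An (ord0 : 'I_2) (lift ord0 ord0).
    exists (Subgroup eP).
      split; last by rewrite /= dotBl !dot_delta !mxE.
      by apply/eqP => /(congr1 val)/matrixP/(_ 0 0); rewrite !mxE.
    move=> x; have /andP[/mxOverP/(_ 0 0)/intrP[k Ek]] := valP x.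
    rewrite !big_ord_recl big_ord0 addr0 addrC addr_eq0 => /eqP x1.
    exists k; apply: val_inj; apply/rowP => i.
    rewrite raddfMz /= -scaler_int !mxE.
    have [->|->] : i = ord0 \/ i = lift ord0 ord0.
      by case: i => -[|[|//]] h; [left|right]; apply: val_inj.
      by rewrite Ek mulr1.
    by rewrite x1 Ek mulrN1.
  apply: (short_pair_restrict (delta_An (ord0 : 'I_l.+3) (lift ord0 ord0))
             (delta_An (ord0 : 'I_l.+3) (lift ord0 (lift ord0 ord0))));
  by rewrite dotBl !dot_delta !mxE.
- case: l => [|[|l]] // _; right.
  have [uP wP] := delta_Dn (ord0 : 'I_l.+2) (lift ord0 ord0).
  by apply: (short_pair_restrict uP wP); rewrite ?dotBl ?dotDl !dot_delta !mxE.
- move=> _; right.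
  have [uP wP] := delta_Dn (ord0 : 'I_8) (lift ord0 ord0).
  (* The indices 5, 6, 7 are the coordinates 6, 7, 8 of the definition of [E_6]; vectors of [D_8]
     vanishing there satisfy both orthogonality conditions. *)
  have E u : u \in Dn_pred 8 -> u 0 (inord 5) = 0 -> u 0 (inord 6) = 0 ->
      u 0 (inord 7) = 0 -> u \in E6_pred.
    move=> uD u5 u6 u7; have uE : u \in E8_pred by rewrite inE uD.
    rewrite inE uE /= dotC dotDl !dot_delta.
    by rewrite [dot _ (_ + _)]dotC dotDl !dot_delta u5 u6 u7 addr0 eqxx.
  apply: (@short_pair_restrict 8 E6_pred _ _ (E _ uP _ _ _) (E _ wP _ _ _));
    by rewrite ?dotBl ?dotDl ?dot_delta !mxE // -!val_eqE /= !inordK.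
- move=> _; right.
  have [uP wP] := delta_Dn (ord0 : 'I_8) (lift ord0 ord0).
  have E u : u \in Dn_pred 8 -> u 0 (inord 6) = 0 -> u 0 (inord 7) = 0 ->
      u \in E7_pred.
    move=> uD u6 u7; have uE : u \in E8_pred by rewrite inE uD.
    rewrite inE uE /= dotC dotDl !dot_delta.
    by rewrite u6 u7 addr0 eqxx.
  apply: (@short_pair_restrict 8 E7_pred _ _ (E _ uP _ _) (E _ wP _ _));
    by rewrite ?dotBl ?dotDl ?dot_delta !mxE // -!val_eqE /= !inordK.
move=> _; right.
have [uP wP] := delta_Dn (ord0 : 'I_8) (lift ord0 ord0).
have E u : u \in Dn_pred 8 -> u \in E8_pred by move=> uD; rewrite inE uD.
apply: (@short_pair_restrict 8 E8_pred _ _ (E _ uP) (E _ wP));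
  by rewrite ?dotBl ?dotDl ?dot_delta !mxE.
Qed.

Lemma pair_mulrz (U V : zmodType) (x : U) (y : V) (k : int) :
  (x, y) *~ k = (x *~ k, y *~ k).
Proof.
have pairMn m : (x, y) *+ m = (x *+ m, y *+ m).
  by elim: m => [|m IH]; rewrite ?mulr0n // !mulrS IH.
by case: k => m; rewrite ?NegzE ?mulrNz -!pmulrn pairMn.
Qed.

(** Short vectors from two different summands are orthogonal and so form a pair. Hence if the tail
    contains a short vector a pair exists, and if the tail is zero the head decides. The zero
    alternative is the empty sum. *)
Lemma root_sum_short ts : all valid_root_type ts ->
  [\/ forall x : root_sum ts, x = 0, short_cyclic (root_sum ts)
    | short_pair (root_sum ts)].
Proof.
elim: ts => [|t ts IH] /=; first by move=> _; apply: Or31 => x; apply/rowP => -[].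
move=> /andP[tv /IH{IH} IH].
have liftl (x : basic_lattice t) : short x -> short ((x, 0) : root_sum (t :: ts)).
  move=> [x0 x2]; split; last by rewrite /= root_sum_0 addr0.
  by rewrite xpair_eqE (negPf x0).
have liftr (y : root_sum ts) : short y -> short ((0, y) : root_sum (t :: ts)).
  move=> [y0 y2]; split; last by rewrite /= basic_lattice_0 add0r.
  by rewrite xpair_eqE (negPf y0) andbF.
have mixed (x : basic_lattice t) (y : root_sum ts) : short x -> short y ->
    short_pair (root_sum (t :: ts)).
  move=> sx sy; exists (x, 0), (0, y).
  have [/eqP x0 _] := sx.
  split; [exact: liftl | exact: liftr | by case=> /x0 | ].
  by case=> E _; apply: x0; rewrite E oppr0.
have [x sx] : exists x : basic_lattice t, short x.
  by case: (basic_lattice_short tv) => [[e se _] | [e [w [se _ _ _]]]]; exists e.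
case: IH => [ts0|[y sy _]|[y [_ [sy _ _ _]]]]; last 2 first.
- by apply: Or33; apply: mixed sx sy.
- by apply: Or33; apply: mixed sx sy.
case: (basic_lattice_short tv) => [[e se ge]|[u [w [su sw uw uNw]]]].
  apply: Or32; exists (e, 0); first exact: liftl.
  move=> [z z']; have [k ->] := ge z; exists k; rewrite (ts0 z').
  by rewrite [RHS](pair_mulrz e 0 k) mul0rz.
apply: Or33; exists (u, 0), (w, 0); split;
  [exact: liftl | exact: liftl | by case | by case].
Qed.

Lemma root_lattice_pos (L : formModule) : is_root_lattice L ->
  forall x : L, x != 0 -> 0 < fm_form x x.
Proof.
move=> [_ _ [ts _ [f [[g fg gf] fi]]]] x x0.
rewrite -fi root_sum_gt0 //; apply: contraNneq x0 => fx0.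
by rewrite -[x]fg fx0; have := fg 0; rewrite raddf0 => ->.
Qed.

Lemma root_lattice_short (L : formModule) : is_root_lattice L ->
  short_cyclic L \/ short_pair L.
Proof.
move=> [_ [x0 /eqP x00] [ts tv [f [[g fg gf] fi]]]].
have g0 : g 0 = 0 by have := fg 0; rewrite raddf0.
have gs y : short y -> short (g y).
  move=> [y0 y2]; split; last by rewrite -fi gf.
  by apply: contraNneq y0 => gy0; rewrite -[y]gf gy0 raddf0.
case: (root_sum_short tv) => [ts0|[e se ge]|[u [w [su sw uw uNw]]]].
- by case: x00; rewrite -(fg x0) (ts0 (f x0)) g0.
- left; exists (g e); first exact: gs.
  move=> x; have [k Ek] := ge (f x); exists k.
  by apply: (can_inj fg); rewrite raddfMz gf.
right; exists (g u), (g w); split; [exact: gs | exact: gs | |].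
  by move/(congr1 f); rewrite !gf.
by move/(congr1 f); rewrite raddfN !gf.
Qed.

(** * From root lattices to fields *)

Section Involution.
Variables (K : fieldExtType rat) (theta : {rmorphism K -> K}).
Hypothesis theta_inv : forall x, theta (theta x) = x.

(** [theta] is linear over the rationals and of square 1, and conjugating multiplication by [x] with
    it gives multiplication by [theta x]; the two matrices are similar. *)
Lemma fieldTrace_involution x : fieldTrace (theta x) = fieldTrace x.
Proof.
have theta_lin : linear theta.
  by move=> q y z; rewrite rmorphD /= fmorph_numZ.
pose theta_l := GRing.isLinear.Build _ _ _ _ theta theta_lin.
pose lth : {linear K -> K} := HB.pack (theta : K -> K) theta_l.
pose T := mxof (vbasis {:K}) (vbasis {:K}) (linfun lth).
have conjT : mulmat (theta x) = T *m mulmat x *m T.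
  rewrite /T /mulmat -!mxof_comp ?vbasisP //; congr mxof.
  apply/lfunP => z; rewrite !comp_lfunE !lfunE /=.
  by rewrite rmorphM /= theta_inv.
have TT : T *m T = 1%:M.
  rewrite /T -mxof_comp ?vbasisP // -mulmat1; congr mxof.
  by apply/lfunP => z; rewrite !comp_lfunE !lfunE /= theta_inv mulr1.
by rewrite -[LHS]/(\tr (mulmat (theta x))) conjT mxtrace_mulC mulmxA TT mul1mx.
Qed.

End Involution.

Section Rational.
Variable K : fieldExtType rat.
Implicit Types (x y z s : K) (p q : rat).

Lemma ratK_inj p q : p%:A = q%:A :> K -> p = q.
Proof. exact: (fmorph_inj (in_alg K)). Qed.

Lemma dim1_rational : (forall x, exists q, x = q%:A) -> {:K}%VS = 1%VS.
Proof.
move=> Q; apply/eqP; rewrite eqEsubv subvf andbT; apply/subvP => x _.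
by have [q ->] := Q x; rewrite rpredZ // mem1v.
Qed.

Lemma dim2_coords x : \dim {:K} = 2 -> x \notin 1%VS ->
  forall y, exists p q, y = p%:A + q *: x.
Proof.
move=> d2 x1 y.
have x0 : x != 0 by apply: contraNneq x1 => ->; rewrite mem0v.
have fr : free [:: x; 1].
  by rewrite free_cons span_seq1 x1 seq1_free oner_neq0.
have /eqP sp : <<[:: x; 1%R]>>%VS == {:K}%VS.
  by rewrite -dimv_leqif_eq ?subvf // (eqP fr) d2.
have : y \in <<[:: x; 1%R]>>%VS by rewrite sp memvf.
rewrite span_cons span_seq1 => /memv_addP[_ /vlineP[q ->]] [_ /vlineP[p ->]] ->.
by exists p, q; rewrite addrC.
Qed.

Lemma adjoin_full x : \dim {:K} = 2 -> x \notin 1%VS -> <<1; x>>%VS = {:K}%VS.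
Proof.
move=> d2 x1; apply/eqP; rewrite eqEsubv subvf /=; apply/subvP => y _.
have [p [q ->]] := dim2_coords d2 x1 y.
by rewrite rpredD ?rpredZ ?memv_adjoin ?mem1v.
Qed.

End Rational.

(** * Imaginary quadratic fields in coordinates *)

Section Quadratic.
Variables (K : fieldExtType rat) (s : K) (d : int).
Hypotheses (d_lt0 : d < 0) (s_sqr : s ^+ 2 = d%:~R).
Implicit Types (x y z : K) (p q : rat).

Lemma quad_mul p q p' q' : (p%:A + q *: s) * (p'%:A + q' *: s) =
  (p * p' + d%:~R * (q * q'))%:A + (p * q' + q * p') *: s.
Proof.
have sA r : r *: s = r%:A * s by rewrite mulr_algl.
rewrite !sA -![_%:A]/(in_alg K _) !(rmorphD, rmorphM) /=.
have -> : (d%:~R)%:A = s ^+ 2 by rewrite s_sqr alg_num_field ratr_int.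
by ring.
Qed.

(** Multiplication by [p - q s] gives [p^2 - d q^2 = 0], where both terms are nonnegative because
    [d < 0]. *)
Lemma quad_eq0 p q : p%:A + q *: s = 0 -> p = 0 /\ q = 0.
Proof.
move=> E0; have := quad_mul p q p (- q); rewrite E0 mul0r.
have -> : p * - q + q * p = 0 by ring.
rewrite scale0r addr0 -(scale0r (1 : K)) => /esym/ratK_inj N0.
have d0 : d%:~R < 0 :> rat by rewrite ltrz0.
have q0 : q = 0.
  apply/eqP; rewrite -sqrf_eq0 eq_le sqr_ge0 andbT.
  have p2 := sqr_ge0 p; rewrite leNgt; apply/negP => q2.
  have := mulr_gt0 q2 (_ : 0 < - d%:~R :> rat); rewrite oppr_gt0 => /(_ d0).
  by move: N0; lra.
split=> //; apply/eqP; rewrite -sqrf_eq0; apply/eqP.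
by move: N0; rewrite q0; lra.
Qed.

Lemma quad_inj p q p' q' :
  p%:A + q *: s = p'%:A + q' *: s -> p = p' /\ q = q'.
Proof.
move=> /eqP; rewrite -subr_eq0 opprD addrACA -!scalerBl => /eqP/quad_eq0[].
by move=> /eqP; rewrite subr_eq0 => /eqP-> /eqP; rewrite subr_eq0 => /eqP->.
Qed.

Lemma quad_not_rat : s \notin 1%VS.
Proof.
apply/vlineP => -[q Es].
have [] := @quad_inj q 0 0 1; first by rewrite scale0r addr0 scale0r add0r scale1r.
by move=> _ /esym/eqP; rewrite oner_eq0.
Qed.

(** The embedding is built by hand on chosen coordinates. These are unique, so it may be evaluated
    on any expression [p + q s], and multiplicativity reduces to [w^2 = d]. *)
Lemma quad_complex_conj (theta : {rmorphism K -> K}) :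
    (forall y, exists p q, y = p%:A + q *: s) -> theta s = - s ->
  is_complex_conj theta.
Proof.
move=> coords ths.
have /choice[c cP] : forall y, exists c : rat * rat, y = c.1%:A + c.2 *: s.
  by move=> y; have [p [q E]] := coords y; exists (p, q).
(* Written as ['i] times the square root of the positive number [-d], this root of [d] is purely
   imaginary, so conjugation negates it. *)
pose w : algC := 'i * sqrtC (- d)%:~R.
have w2 : w ^+ 2 = d%:~R by rewrite exprMn sqrCi sqrtCK mulN1r -intrN opprK.
have wc : w^* = - w.
  rewrite rmorphM /= conjCi mulNr; congr (- (_ * _)).
  by apply: conj_Creal; rewrite ger0_real // sqrtC_ge0 ler0z oppr_ge0 ltW.
pose iota y : algC := ratr (c y).1 + ratr (c y).2 * w.
have iotaE p q : iota (p%:A + q *: s) = ratr p + ratr q * w.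
  by rewrite /iota; have /quad_inj[<- <-] := cP (p%:A + q *: s).
have iotaB : zmod_morphism iota.
  move=> x y; rewrite {1}[x]cP {1}[y]cP opprD addrACA -!scalerBl iotaE /iota.
  by rewrite !rmorphB /=; ring.
have iotaM : monoid_morphism iota.
  split.
    rewrite -[1 in LHS]addr0 -[1 in LHS]scale1r -(scale0r s) iotaE.
    by rewrite rmorph1 rmorph0 mul0r addr0.
  move=> x y; rewrite {1}[x]cP {1}[y]cP quad_mul iotaE /iota.
  by rewrite !(rmorphD, rmorphM) /= ratr_int -w2; ring.
pose iota_m : {rmorphism K -> algC} := HB.pack iota
  (GRing.isZmodMorphism.Build _ _ iota iotaB)
  (GRing.isMonoidMorphism.Build _ _ iota iotaM).
exists iota_m => x.
rewrite -[LHS]/(iota _) -[iota_m x]/(iota x) [x]cP.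
rewrite rmorphD !fmorph_numZ rmorph1 ths scalerN -scaleNr !iotaE.
have cr p : (ratr p : algC)^* = ratr p by apply: fmorph_rat.
by rewrite [RHS]rmorphD [X in _ = _ + X]rmorphM /= !cr wc rmorphN; ring.
Qed.

End Quadratic.

Section Forward.
Variables (K : fieldExtType rat) (theta : {rmorphism K -> K}).
Hypothesis theta_inv : forall x, theta (theta x) = x.
Local Notation form := (trace_form theta).
Hypothesis form_pos : forall x, x != 0 -> 0 < form x x.

Lemma quadratic_cases x : \dim {:K} = 2 -> x \notin 1%VS -> is_integral x ->
    x * theta x = 1 ->
  (is_Q_sqrt K (- 3) \/ is_Q_sqrt K (- 1)) /\ is_complex_conj theta.
Proof.
move=> d2 x1 xO xtx.
have thx : theta x != x.
  apply: contraNneq x1 => thx; move: xtx; rewrite thx -expr2 => /eqP.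
  by rewrite sqrf_eq1 => /orP[] /eqP->; rewrite ?rpredN mem1v.
have fixedQ y : theta y = y -> exists q, y = q%:A.
  have [p [q ->]] := dim2_coords d2 x1 y.
  rewrite rmorphD !fmorph_numZ rmorph1 => /addrI/eqP.
  rewrite -subr_eq0 -scalerBr scaler_eq0 subr_eq0 (negPf thx) orbF => /eqP->.
  by exists p; rewrite scale0r addr0.
have [c Ec] : exists c, x + theta x = c%:A.
  by apply: fixedQ; rewrite rmorphD theta_inv addrC.
have /intrP[m Em] : c \is a Num.int.
  apply: (@integral_rat K); rewrite -Ec; apply: integral_add => //.
  exact: integral_theta.
pose s := x - theta x.
have s0 : s != 0 by rewrite subr_eq0 eq_sym.
have ths : theta s = - s by rewrite rmorphB theta_inv opprB.
have s2 : s ^+ 2 = (c ^+ 2 - 4)%:A.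
  have -> : s ^+ 2 = (x + theta x) ^+ 2 - 4 * (x * theta x) by rewrite /s; ring.
  rewrite Ec xtx mulr1 -![_%:A]/(in_alg K _) rmorphB rmorphXn /=.
  by rewrite -[4%:A]/(in_alg K _) rmorph_nat.
(* Since [theta s = - s], the norm of [s] is [- Tr (s^2) = 2 (4 - c^2)], which is positive. *)
have c4 : c ^+ 2 < 4.
  have := form_pos s0; rewrite /trace_form ths mulrN -expr2 s2 -scaleNr fieldTraceZ.
  by rewrite fieldTrace1 d2; lra.
have s1 : s \notin 1%VS.
  apply/vlineP => -[q Es]; move: ths; rewrite Es fmorph_numZ rmorph1 -Es => /eqP.
  by rewrite -addr_eq0 -mulr2n -scaler_nat scaler_eq0 (negPf s0) orbF.
have concl (d : int) (r : rat) : d < 0 -> r != 0 -> (r *: s) ^+ 2 = d%:~R ->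
    is_Q_sqrt K d /\ is_complex_conj theta.
  move=> dn r0 rs2.
  have rs1 : r *: s \notin 1%VS by rewrite rpredZeq (negPf r0).
  split; first by exists (r *: s) => //; apply: adjoin_full.
  apply: (quad_complex_conj dn rs2); first exact: dim2_coords.
  by rewrite fmorph_numZ ths scalerN.
have algZ (q : rat) (d : int) : q = d%:~R -> q%:A = d%:~R :> K.
  by move=> ->; rewrite alg_num_field ratr_int.
(* For [c = 0] one has [s^2 = -4], and [s / 2] is a square root of -1; otherwise [c^2 = 1] and
   [s^2 = -3]. *)
have [c0|c0] := eqVneq c 0.
  have [] := concl (- 1) (1 / 2) isT isT.
    by rewrite exprZn s2 c0 scalerA; apply: algZ.
  by move=> ? ?; split => //; right.
have c1 : c ^+ 2 = 1.
  move: c4 c0; rewrite Em -rmorphXn /= -[4]/(4%:~R) ltr_int intr_eq0 => m4 m0.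
  suff -> : m ^+ 2 = 1 by [].
  by have : m = 1 \/ m = -1; [nia | case => ->].
have [] := concl (- 3) 1 isT isT.
  by rewrite scale1r s2 c1; apply: algZ.
by move=> ? ?; split => //; left.
Qed.

End Forward.

Lemma root_lattice_cases (K : fieldExtType rat) (theta : {rmorphism K -> K})
    (theta_inv : forall x : K, theta (theta x) = x) :
  is_root_lattice (ringO_lattice theta) ->
  [\/ ({:K}%VS = 1%VS /\ forall x : K, theta x = x),
      (is_Q_sqrt K (- 3) /\ is_complex_conj theta)
    | (is_Q_sqrt K (- 1) /\ is_complex_conj theta)].
Proof.
move=> rootL.
have pos := root_lattice_pos rootL; have sh := root_lattice_short rootL.
have OP (x : ringO_lattice theta) : is_integral (val x) by apply/asboolP; have := valP x.
have inO (x : K) : is_integral x -> x \in @ringO_pred K.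
  by move=> xO; rewrite inE; apply/asboolP.
have [[_ _ _ symL _] _ _] := rootL.
have [form_sym form_pos] :
    (forall x y : K, trace_form theta x y = trace_form theta y x) /\
    (forall x : K, x != 0 -> 0 < trace_form theta x x).
  apply: trace_form_extend => [x y /inO xO /inO yO|x /inO xO x0].
    exact: (symL (Subgroup xO) (Subgroup yO)).
  by apply: (pos (Subgroup xO)); apply: contraNneq x0 => /(congr1 val) /= ->.
have ratcase : (forall x : K, exists q, x = q%:A) ->
    {:K}%VS = 1%VS /\ forall x : K, theta x = x.
  move=> Q; split=> [|x]; first exact: dim1_rational.
  by have [q ->] := Q x; rewrite fmorph_numZ rmorph1.
case: sh => [[e [e0 _] ge]|[x [y [[x0 x2] [y0 y2] xy xNy]]]].
  apply: Or31; apply: ratcase => z.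
  (* Both 1 and some nonzero integer multiple of [z] are integer multiples of the generator [e], so
     [z] is rational. *)
  have val_e (k : int) : val (e *~ k) = k%:~R *: val e by rewrite raddfMz scaler_int.
  have [a a0 /inO azO] := integral_multiple z.
  have [k /(congr1 val)] := ge (Subgroup azO); rewrite val_e /= => Ez.
  have [l /(congr1 val)] := ge (Subgroup (inO _ (integral_int K 1))).
  rewrite val_e /= => E; have {E}E1 : (1 : K) = l%:~R *: val e := E.
  have l0 : l%:~R != 0 :> rat.
    by apply/eqP => l0; move/eqP: E1; rewrite l0 scale0r oner_eq0.
  exists (a%:~R^-1 * k%:~R * l%:~R^-1).
  rewrite E1 scalerA mulfVK // -scalerA -Ez mulrzl -scaler_int.
  by rewrite scalerA mulVf ?scale1r // intr_eq0.
have v0 (z : ringO_lattice theta) : z != 0 -> val z != 0.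
  by move=> z0; apply: contraNneq z0 => z0; apply/eqP/val_inj.
have [n2 xone] := trace_form_integral_ge form_sym form_pos (OP x) (v0 _ x0).
have [_ yone] := trace_form_integral_ge form_sym form_pos (OP y) (v0 _ y0).
have n_le2 : (\dim {:K} <= 2)%N by rewrite -(ler_nat rat) (le_trans n2).
have n_gt0 : (0 < \dim {:K})%N by rewrite adim_gt0.
have [n1|nn1] := eqVneq (\dim {:K}) 1%N.
  apply: Or31; apply: ratcase => z.
  have : z \in 1%VS.
    suff -> : 1%VS = {:K}%VS by rewrite memvf.
    by apply/eqP; rewrite -dimv_leqif_eq ?subvf // dimv1 n1.
  by case/vlineP => q ->; exists q.
have d2 : \dim {:K} = 2%N by lia.
have two (z : ringO_lattice theta) :
    z != 0 -> fm_form z z <= 2 -> val z * theta (val z) = 1.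
  move=> z0 z2.
  have [n2z zone] := trace_form_integral_ge form_sym form_pos (OP z) (v0 _ z0).
  by apply: zone; apply/eqP; rewrite eq_le n2z d2 andbT.
have rat1 (z : ringO_lattice theta) :
    z != 0 -> fm_form z z <= 2 -> val z \in 1%VS ->
    val z = 1 \/ val z = - 1.
  move=> z0 z2 /vlineP[q Eq]; have := two z z0 z2.
  rewrite Eq fmorph_numZ rmorph1 -expr2 => /eqP.
  by rewrite sqrf_eq1 => /orP[] /eqP; [left|right].
have [z [z0 z2 z1]] : exists z : ringO_lattice theta,
    [/\ z != 0, fm_form z z <= 2 & val z \notin 1%VS].
  have [xQ|xQ] := boolP (val x \in 1%VS); last by exists x.
  have [yQ|yQ] := boolP (val y \in 1%VS); last by exists y.
  exfalso.
  case: (rat1 _ x0 x2 xQ) => Ex; case: (rat1 _ y0 y2 yQ) => Ey.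
  - by apply: xy; apply: val_inj; rewrite Ex Ey.
  - by apply: xNy; apply: val_inj; rewrite raddfN /= Ex Ey opprK.
  - by apply: xNy; apply: val_inj; rewrite raddfN /= Ex Ey.
  - by apply: xy; apply: val_inj; rewrite Ex Ey.
have [[s3|s1] cc] := quadratic_cases theta_inv form_pos d2 z1 (OP z) (two _ z0 z2).
  exact: Or32.
exact: Or33.
Qed.

(** * From fields to root lattices *)

(** A form-preserving map out of a positive definite module is injective, since a vector of its
    kernel has norm 0. With surjectivity the inverse exists, and injectivity makes it additive. *)
Lemma isometric_of_onto (L M : formModule) (h : {additive M -> L}) :
    (forall x : M, x != 0 -> 0 < fm_form x x) -> fm_form (0 : L) 0 = 0 ->
    (forall x y, fm_form (h x) (h y) = fm_form x y) ->
    (forall y, exists x, h x = y) ->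
  isometric L M.
Proof.
move=> Mpos L0 hi /choice[g gK].
have hinj : injective h.
  apply: raddf_inj => x hx0; apply/eqP; apply: contraTT isT => x0.
  by have := Mpos x x0; rewrite -hi hx0 L0 ltxx.
have gB : zmod_morphism g by move=> x y; apply: hinj; rewrite raddfB !gK.
pose f : {additive L -> M} := HB.pack g (GRing.isZmodMorphism.Build _ _ g gB).
exists f; split; last by move=> x y; rewrite -hi !gK.
by exists h => [x|y]; [exact: gK | apply: hinj; exact: gK].
Qed.

Lemma Zfree_rank1 (L : zmodType) (e : L) :
    (forall x, exists u : int, x = e *~ u) ->
    (forall u : int, e *~ u = 0 -> u = 0) ->
  Zfree_finite_rank L.
Proof.
move=> gen ind; exists 1%N, (fun=> e) => x; have [u Eu] := gen x.
exists [ffun=> u]; split; first by rewrite big_ord1 ffunE.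
move=> c; rewrite big_ord1 => Ec; apply/ffunP => i; rewrite ffunE ord1.
by apply/eqP; rewrite -subr_eq0; apply/eqP/ind; rewrite mulrzBr -Eu -Ec subrr.
Qed.

Lemma Zfree_rank2 (L : zmodType) (e f : L) :
    (forall x, exists u v : int, x = e *~ u + f *~ v) ->
    (forall u v : int, e *~ u + f *~ v = 0 -> u = 0 /\ v = 0) ->
  Zfree_finite_rank L.
Proof.
move=> gen ind; exists 2%N, (fun i => if i == ord0 then e else f) => x.
have [u [v Ex]] := gen x.
exists [ffun i => if i == ord0 then u else v]; split.
  by rewrite big_ord_recl big_ord1 !ffunE.
move=> c; rewrite big_ord_recl big_ord1 /= => Ec.
have [|/eqP] := ind (u - c ord0) (v - c (lift ord0 ord0)).
  by rewrite !mulrzBr addrACA -opprD -Ex -Ec subrr.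
rewrite subr_eq0 => /eqP Eu /eqP; rewrite subr_eq0 => /eqP Ev.
apply/ffunP => i; rewrite ffunE; case: i => -[|[|//]] hi /=.
  by rewrite Eu; congr (c _); apply: val_inj.
by rewrite Ev; congr (c _); apply: val_inj.
Qed.

Lemma ringO1 (K : fieldExtType rat) : (1 : K) \in @ringO_pred K.
Proof. by rewrite inE; apply/asboolP; exact: (integral_int K 1). Qed.

Section Backward.
Variables (K : fieldExtType rat) (theta : {rmorphism K -> K}).
Hypothesis theta_inv : forall x, theta (theta x) = x.
Local Notation L := (ringO_lattice theta).

(** The isometry pulls positivity back to the integers of [K], which gives nondegeneracy; symmetry
    holds because [theta] preserves the trace. *)
Lemma ringO_root_lattice ts : all valid_root_type ts -> Zfree_finite_rank L ->
    (forall x y : L, fm_form x y \is a Num.int) -> isometric L (root_sum ts) ->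
  is_root_lattice L.
Proof.
move=> tv Lfree LZ Liso; have [f [fbij fi]] := Liso.
have Lpos (x : L) : x != 0 -> 0 < fm_form x x.
  move=> x0; rewrite -fi root_sum_gt0 //; apply: contraNneq x0 => fx0.
  by apply/eqP/(bij_inj fbij); rewrite fx0 raddf0.
split; last by exists ts.
- split => //.
  + by move=> x y z; rewrite /= /trace_form mulrDl fieldTraceD.
  + move=> x y; rewrite /= /trace_form -[LHS](fieldTrace_involution theta_inv).
    by rewrite rmorphM theta_inv mulrC.
  move=> x x0; apply/eqP; apply: contraTT isT => /Lpos.
  by rewrite x0 ltxx.
exists (Subgroup (ringO1 K)); apply/eqP => /(congr1 val) /= /eqP.
by rewrite oner_eq0.
Qed.

Lemma root_lattice_rational : {:K}%VS = 1%VS -> (forall x : K, theta x = x) ->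
  is_root_lattice L.
Proof.
move=> K1 th1.
have d1 : \dim {:K} = 1%N by rewrite K1 dimv1.
have ratK (z : K) : exists q, z = q%:A.
  by have : z \in 1%VS; [rewrite -K1 memvf | case/vlineP => q ->; exists q].
have formE (p q : rat) : trace_form theta p%:A q%:A = p * q.
  by rewrite /trace_form th1 mulr_algl scalerA fieldTraceZ fieldTrace1 d1 mulr1.
have inO (p : rat) : p \is a Num.int -> p%:A \in @ringO_pred K.
  move=> /intrP[k ->]; rewrite inE; apply/asboolP.
  by rewrite alg_num_field ratr_int; exact: integral_int.
have Oint (x : L) : exists k : int, val x = k%:~R%:A.
  have [q Eq] := ratK (val x); have /asboolP := valP x; rewrite Eq.
  by move=> /integral_rat/intrP[k ->]; exists k.
have oneE (u : int) : val ((Subgroup (inO 1 isT) : L) *~ u) = u%:~R%:A.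
  by rewrite raddfMz /= -scaler_int scalerA mulr1.
pose M := root_sum [:: TypeZ].
have hP (x : M) : (val x.1 0 0)%:A \in @ringO_pred K.
  by apply: (inO (val x.1 0 0)); have /mxOverP := valP x.1.
pose h (x : M) : L := Subgroup (hP x).
have hB : zmod_morphism h.
  by move=> x y; apply: val_inj; rewrite raddfB /= -scalerBl !mxE.
pose h' : {additive M -> L} := HB.pack h (GRing.isZmodMorphism.Build _ _ h hB).
apply: (@ringO_root_lattice [:: TypeZ]) => //.
- apply: (@Zfree_rank1 _ (Subgroup (inO 1 isT) : L)).
    by move=> x; have [k Ek] := Oint x; exists k; apply: val_inj; rewrite oneE.
  move=> u /(congr1 val); rewrite oneE /= -(scale0r (1 : K)) => /ratK_inj/eqP.
  by rewrite intr_eq0 => /eqP.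
- move=> x y; have [k Ek] := Oint x; have [l El] := Oint y.
  by rewrite /= Ek El formE -intrM intr_int.
apply: (isometric_of_onto (h := h')) => [x||x y|y].
- exact: root_sum_gt0.
- by rewrite /= /trace_form mul0r fieldTrace0.
- by rewrite /= formE /dot big_ord1 addr0.
have [k Ek] := Oint y.
have kP : const_mx k%:~R \in Zn_pred 1.
  by rewrite inE; apply/mxOverP => i j; rewrite mxE intr_int.
by exists (Subgroup kP, 0); apply: val_inj; rewrite /= mxE Ek.
Qed.

End Backward.

(** * Integers and trace form of an imaginary quadratic field *)

Section QuadraticBackward.
Variables (K : fieldExtType rat) (theta : {rmorphism K -> K}) (s : K) (d : int).
Hypothesis theta_inv : forall x, theta (theta x) = x.
Hypotheses (d_lt0 : d < 0) (s_sqr : s ^+ 2 = d%:~R).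
Hypothesis s_gen : <<1; s>>%VS = {:K}%VS.
Hypothesis theta_conj : is_complex_conj theta.
Implicit Types (y z : K) (p q : rat).
Local Notation L := (ringO_lattice theta).

Lemma adjoin_coords y : exists p q, y = p%:A + q *: s.
Proof.
have /Fadjoin1_polyP[f ->] : y \in <<1; s>>%VS by rewrite s_gen memvf.
elim/poly_ind: f => [|f c [p [q IH]]].
  by exists 0, 0; rewrite rmorph0 horner0 !scale0r addr0.
exists (d%:~R * q + c), p.
rewrite rmorphD rmorphM /= map_polyX map_polyC !hornerE IH /=.
rewrite mulrDl mulr_algl -scalerAl -expr2 s_sqr.
have -> : d%:~R = d%:~R%:A :> K by rewrite alg_num_field ratr_int.
by rewrite scalerA -addrA addrC -scalerDl [q * _]mulrC.
Qed.

(** The conjugate of [iota s] has the same square, so it is [iota s] up to sign; equality would make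
    [iota s] real with negative square [d]. *)
Lemma conj_sqrt : theta s = - s.
Proof.
have [iota iotaP] := theta_conj.
apply: (fmorph_inj iota); rewrite iotaP rmorphN.
have w2 : iota s ^+ 2 = d%:~R by rewrite -rmorphXn /= s_sqr rmorph_int.
have : (iota s)^* ^+ 2 = (iota s) ^+ 2 by rewrite -[LHS](rmorphXn Num.conj) w2 rmorph_int.
move=> /eqP; rewrite eqf_sqr => /orP[]/eqP // wR.
have : 0 <= iota s ^+ 2 by rewrite real_exprn_even_ge0 //; apply/CrealP.
by rewrite w2 ler0z leNgt d_lt0.
Qed.

Lemma dim_quad : \dim {:K} = 2.
Proof.
have fr : free [:: s; 1].
  by rewrite free_cons span_seq1 (quad_not_rat d_lt0 s_sqr) seq1_free oner_neq0.
suff <- : <<[:: s; 1%R]>>%VS = {:K}%VS by rewrite (eqP fr).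
apply/eqP; rewrite eqEsubv subvf /=; apply/subvP => y _.
have [p [q ->]] := adjoin_coords y.
by rewrite rpredD // rpredZ // memv_span // !inE eqxx ?orbT.
Qed.

Lemma theta_quad p q : theta (p%:A + q *: s) = p%:A + (- q) *: s.
Proof. by rewrite rmorphD !fmorph_numZ rmorph1 conj_sqrt scalerN scaleNr. Qed.

Lemma trace_quad p q : fieldTrace (p%:A + q *: s) = 2 * p.
Proof.
have ts0 : fieldTrace s = 0.
  have := fieldTrace_involution theta_inv s.
  by rewrite conj_sqrt -scaleN1r fieldTraceZ; lra.
by rewrite fieldTraceD !fieldTraceZ ts0 fieldTrace1 dim_quad; ring.
Qed.

Lemma trace_form_quad p q p' q' :
  trace_form theta (p%:A + q *: s) (p'%:A + q' *: s) = 2 * (p * p' - d%:~R * (q * q')).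
Proof. by rewrite /trace_form theta_quad (quad_mul s_sqr) trace_quad; ring. Qed.

Lemma integral_quad_trace p q : is_integral (p%:A + q *: s) -> 2 * p \is a Num.int.
Proof.
move=> zO; apply: (@integral_rat K).
have -> : (2 * p)%:A = (p%:A + q *: s) + theta (p%:A + q *: s).
  by rewrite theta_quad scaleNr addrACA subrr addr0 -scalerDl -mulr2n mulr_natl.
by apply: integral_add => //; apply: integral_theta.
Qed.

Lemma integral_quad_norm p q : is_integral (p%:A + q *: s) ->
  p ^+ 2 - d%:~R * q ^+ 2 \is a Num.int.
Proof.
move=> zO; apply: (@integral_rat K).
have -> : (p ^+ 2 - d%:~R * q ^+ 2)%:A = (p%:A + q *: s) * theta (p%:A + q *: s).
  rewrite theta_quad (quad_mul s_sqr).
  have -> : p * - q + q * p = 0 by ring.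
  rewrite scale0r addr0.
  by congr (_ *: _); ring.
by apply: integral_mul => //; apply: integral_theta.
Qed.

Lemma integral_sqrt : is_integral s.
Proof.
apply: (integral_root_monic (p := 'X^2 - d%:~R%:P)).
- by rewrite monicXnsubC.
- by rewrite rootE !hornerE s_sqr subrr.
apply/integral_poly => i; rewrite coefB coefXn coefC.
apply: integral_sub; [exact: integral_nat |].
by case: eqP => _; [exact: integral_int | exact: integral0].
Qed.

(** This is the trace of the integral element [s z], where [z = p + q s]; it bounds the denominator
    of [q] as the trace of [z] bounds that of [p]. *)
Lemma integral_quad_trace2 p q : is_integral (p%:A + q *: s) ->
  2 * (d%:~R * q) \is a Num.int.
Proof.
move=> zO; apply: (@integral_quad_trace _ p).
have <- : s * (p%:A + q *: s) = (d%:~R * q)%:A + p *: s.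
  have {1}-> : s = 0%:A + 1 *: s by rewrite scale0r add0r scale1r.
  by rewrite (quad_mul s_sqr); congr (_ *: _ + _ *: _); ring.
by apply: integral_mul => //; apply: integral_sqrt.
Qed.

(* The comparison map goes from the root lattice to [O]: it can be written with the
   entries of the vectors, and its inverse comes for free. *)
Lemma ringO_rank2 (e1 e2 : L) ts (h : {additive root_sum ts -> L}) x1 x2 :
    all valid_root_type ts ->
    (forall z, is_integral z -> exists u v : int, z = val e1 *~ u + val e2 *~ v) ->
    (forall u v : int, val e1 *~ u + val e2 *~ v = 0 -> u = 0 /\ v = 0) ->
    fm_form e1 e1 \is a Num.int -> fm_form e1 e2 \is a Num.int ->
    fm_form e2 e2 \is a Num.int ->
    (forall a b : root_sum ts, fm_form (h a) (h b) = fm_form a b) ->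
    h x1 = e1 -> h x2 = e2 ->
  is_root_lattice L.
Proof.
move=> tv gen ind I11 I12 I22 hi h1 h2.
have gen' (x : L) : exists u v : int, x = e1 *~ u + e2 *~ v.
  have /asboolP/gen[u [v Ex]] := valP x; exists u, v; apply: val_inj.
  by rewrite raddfD !raddfMz.
have I21 : fm_form e2 e1 \is a Num.int.
  rewrite /= /trace_form -(fieldTrace_involution theta_inv) rmorphM theta_inv mulrC.
  exact: I12.
apply: (ringO_root_lattice theta_inv tv).
- apply: (Zfree_rank2 gen') => u v /(congr1 val).
  by rewrite raddfD !raddfMz /= => /ind.
- move=> x y; have [u [v ->]] := gen' x; have [u' [v' ->]] := gen' y.
  rewrite -[fm_form _ _]/(trace_form theta (val _) (val _)) /trace_form.
  rewrite !(raddfD val) !(raddfMz val) rmorphD !rmorphMz.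
  rewrite !mulrDl !mulrDr !fieldTraceD.
  have tZ (z : K) (k : int) : fieldTrace (z *~ k) = k%:~R * fieldTrace z.
    by rewrite -scaler_int fieldTraceZ.
  by rewrite !mulrzAl !mulrzAr !tZ !rpredD // !rpredM // intr_int.
apply: (isometric_of_onto (h := h)) => [x||//|y].
- exact: root_sum_gt0.
- by rewrite /= /trace_form mul0r fieldTrace0.
have [u [v ->]] := gen' y; exists (x1 *~ u + x2 *~ v).
by rewrite raddfD !raddfMz h1 h2.
Qed.

End QuadraticBackward.

Lemma ringO_comb (K : fieldExtType rat) (u v : int) (w : K) :
  is_integral w -> u%:~R%:A + v%:~R *: w \in @ringO_pred K.
Proof.
move=> wO; rewrite inE; apply/asboolP; rewrite alg_num_field ratr_int.
apply: integral_add; first exact: integral_int.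
by rewrite scaler_int -mulrzl; apply: integral_mul => //; exact: integral_int.
Qed.

(** * Congruences for integral coordinates; Gram forms of A_1 and A_2 *)

Lemma int_parity (x : int) : exists u r : int, x = 2 * u + r /\ (r = 0 \/ r = 1).
Proof. by exists (x %/ 2)%Z, (x %% 2)%Z; lia. Qed.
Lemma int_mod3 (x : int) : exists u r : int, x = 3 * u + r /\ (r = 0 \/ r = 1 \/ r = 2).
Proof. by exists (x %/ 3)%Z, (x %% 3)%Z; lia. Qed.
Lemma sqr_multiple3 (k n : int) : k ^+ 2 = 3 * n -> exists j, k = 3 * j.
Proof.
have [j [r [-> r012]]] := int_mod3 k => E; exists j.
by case: r012 E => [->|[->|->]]; lia.
Qed.
(** Applied for [d = -3] to [m = 2 p], [k = -6 q] and the norm [N = p^2 + 3 q^2]. Divisibility by 3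
    gives [k = 3 j], and [m^2 + 3 j^2 = 4 N] forces [m] and [j] to have the same parity. *)
Lemma eisenstein_norm_parity (m k N : int) : 3 * m ^+ 2 + k ^+ 2 = 12 * N ->
  exists u v : int, m = 2 * u - v /\ k = 3 * v.
Proof.
move=> E; have [|j Ej] := @sqr_multiple3 k (4 * N - m ^+ 2); first by lia.
have {}E : m ^+ 2 + 3 * j ^+ 2 = 4 * N by move: E; rewrite Ej; lia.
have [u [r [Eu r01]]] := int_parity m; have [v [t [Ev t01]]] := int_parity j.
have rt : r = t by move: E; rewrite Eu Ev; case: r01 t01 => -> [] ->; lia.
by exists (u + v + t), j; lia.
Qed.
(** Applied for [d = -1] to [m = 2 p], [k = -2 q] and [N = p^2 + q^2]; a sum of two squares
    divisible by 4 has both terms even. *)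
Lemma gaussian_norm_parity (m k N : int) : m ^+ 2 + k ^+ 2 = 4 * N ->
  exists u v : int, m = 2 * u /\ k = 2 * v.
Proof.
have [u [r [-> r01]]] := int_parity m; have [v [t [-> t01]]] := int_parity k => E.
by exists u, v; case: r01 t01 E => -> [] ->; lia.
Qed.

Lemma An_int l (x : basic_lattice (TypeA l)) i : exists k : int, val x 0 i = k%:~R.
Proof. by have /andP[/mxOverP/(_ 0 i)/intrP] := valP x. Qed.

Lemma A1_form (x y : basic_lattice (TypeA 1)) :
  fm_form x y = 2 * (val x 0 0 * val y 0 0).
Proof.
have /andP[_] := valP x; have /andP[_] := valP y.
rewrite /= /dot !big_ord_recl !big_ord0 !addr0 => /eqP Ey /eqP Ex.
have -> : val x 0 (lift ord0 ord0) = - val x 0 0.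
  by apply/eqP; rewrite -addr_eq0 addrC Ex.
have -> : val y 0 (lift ord0 ord0) = - val y 0 0.
  by apply/eqP; rewrite -addr_eq0 addrC Ey.
by rewrite mulrNN -mulr2n mulr_natl.
Qed.

(** The zero-sum condition eliminates the middle coordinate. In the outer two, the simple roots
    [e_1 - e_2] and [e_2 - e_3] become [(1, 0)] and [(0, -1)]. *)
Lemma A2_form (x y : basic_lattice (TypeA 2)) :
  let x0 := val x 0 ord0 in let x2 := val x 0 ord_max in
  let y0 := val y 0 ord0 in let y2 := val y 0 ord_max in
  fm_form x y = 2 * (x0 * y0) + x0 * y2 + x2 * y0 + 2 * (x2 * y2).
Proof.
have /andP[_] := valP x; have /andP[_] := valP y.
have -> : ord_max = lift ord0 (lift ord0 ord0) :> 'I_3 by apply: val_inj.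
rewrite /= /dot !big_ord_recl !big_ord0 !addr0 => /eqP Ey /eqP Ex.
set b := lift ord0 (lift ord0 ord0) in Ex Ey *; set a := lift ord0 ord0 in Ex Ey *.
have -> : subgroup_val x 0 a = - subgroup_val x 0 ord0 - subgroup_val x 0 b by lra.
have -> : subgroup_val y 0 a = - subgroup_val y 0 ord0 - subgroup_val y 0 b by lra.
by ring.
Qed.

Lemma root_lattice_gaussian (K : fieldExtType rat) (theta : {rmorphism K -> K}) :
    (forall x, theta (theta x) = x) ->
    is_Q_sqrt K (- 1) -> is_complex_conj theta ->
  is_root_lattice (ringO_lattice theta).
Proof.
move=> theta_inv [s s2 s_gen] cc.
pose L := ringO_lattice theta; pose M := root_sum [:: TypeA 1; TypeA 1].
have formE := trace_form_quad theta_inv (isT : (- 1 : int) < 0) s2 s_gen cc.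
have sO : s \in @ringO_pred K by rewrite inE; apply/asboolP; exact: integral_sqrt s2.
(* The two copies of [A_1] go to the multiples of 1 and of [s], which are orthogonal of norm 2. *)
have hP (x : M) : (val x.1 0 0)%:A + val x.2.1 0 0 *: s \in @ringO_pred K.
  have [u ->] := An_int x.1 0; have [v ->] := An_int x.2.1 0.
  by apply: ringO_comb; exact: integral_sqrt s2.
pose h (x : M) : L := Subgroup (hP x).
have hB : zmod_morphism h.
  move=> x y; apply: val_inj; rewrite raddfB /= !mxE !scalerBl opprD.
  by rewrite addrACA.
pose h' : {additive M -> L} := HB.pack h (GRing.isZmodMorphism.Build _ _ h hB).
pose a : basic_lattice (TypeA 1) := Subgroup (delta_An (ord0 : 'I_2) (lift ord0 ord0)).
apply: (@ringO_rank2 _ _ theta_inv (Subgroup (ringO1 K)) (Subgroup sO)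
          [:: TypeA 1; TypeA 1] h' (a, 0) (0, (a, 0))) => //.
- move=> z zO; have [p [q Ez]] := adjoin_coords s2 s_gen z; rewrite Ez in zO *.
  have /intrP[m Em] := integral_quad_trace (isT : (- 1 : int) < 0) s2 cc zO.
  have /intrP[k Ek] := integral_quad_trace2 (isT : (- 1 : int) < 0) s2 cc zO.
  have /intrP[N EN] := integral_quad_norm (isT : (- 1 : int) < 0) s2 cc zO.
  have mkN : m ^+ 2 + k ^+ 2 = 4 * N.
    apply: (intr_inj (R := rat)); rewrite rmorphD !rmorphXn rmorphM /= -Em -Ek -EN.
    by rewrite -[(- 1)%:~R]/(-1 : rat) -[4%:~R]/(4 : rat); ring.
  have [u [v [Eu Ev]]] := gaussian_norm_parity mkN.
  (* The sign comes from [k = 2 d q = -2 q]. *)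
  exists u, (- v); rewrite /= -!scaler_int; congr (_ *: _ + _ *: _).
    by move: Em; rewrite Eu rmorphM /=; lra.
  by move: Ek; rewrite Ev rmorphM rmorphN /=; lra.
- move=> u v; rewrite /= -!scaler_int => /(quad_eq0 (isT : (- 1 : int) < 0) s2)[].
  by move=> /eqP; rewrite intr_eq0 => /eqP -> /eqP; rewrite intr_eq0 => /eqP ->.
- by have := formE 1 0 1 0; rewrite !scale1r !scale0r !addr0 => /= ->.
- by have := formE 1 0 0 1; rewrite !scale1r !scale0r addr0 add0r => /= ->.
- by have := formE 0 1 0 1; rewrite !scale1r !scale0r !add0r => /= ->.
- move=> x y; rewrite -[RHS]/(fm_form x.1 y.1 + (fm_form x.2.1 y.2.1 + 0)) !A1_form.
  by rewrite [LHS]formE -[(- 1)%:~R]/(-1 : rat); ring.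
- apply: val_inj; rewrite /= !mxE /=.
  by rewrite subr0 scale1r scale0r addr0.
- apply: val_inj; rewrite /= !mxE /=.
by rewrite subr0 scale1r scale0r add0r.
Qed.

Lemma root_lattice_eisenstein (K : fieldExtType rat) (theta : {rmorphism K -> K}) :
    (forall x, theta (theta x) = x) ->
    is_Q_sqrt K (- 3) -> is_complex_conj theta ->
  is_root_lattice (ringO_lattice theta).
Proof.
move=> theta_inv [s s2 s_gen] cc.
have d_lt0 : (- 3 : int) < 0 by [].
have d3 : (- 3)%:~R = - 3 :> rat by [].
pose L := ringO_lattice theta; pose M := root_sum [:: TypeA 2].
have formE := trace_form_quad theta_inv d_lt0 s2 s_gen cc.
(* A primitive cube root of unity, root of [X^2 + X + 1]; the integers of [K] have basis [1, w]. *)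
pose w : K := (- (1 / 2))%:A + (1 / 2) *: s.
have combE (p q : rat) : p%:A + q *: w = (p - q / 2)%:A + (q / 2) *: s.
  by rewrite /w scalerDr !scalerA addrA -scalerDl; congr (_ *: _ + _ *: _); field.
have w_int : is_integral w.
  apply: (integral_root_monic (p := 'X^2 + ('X + 1%:P))).
  - by rewrite monicE lead_coefDl ?lead_coefXn // size_polyXn size_XaddC.
  - have w1 : w + 1 = (1 / 2)%:A + (1 / 2) *: s.
      have := combE 1 1; rewrite !scale1r addrC => ->.
      by congr (_ *: _ + _ *: _); field.
    have w2 : w ^+ 2 = (- (1 / 2))%:A + (- (1 / 2)) *: s.
      by rewrite expr2 (quad_mul s2) d3; congr (_ *: _ + _ *: _); field.
    rewrite rootE !hornerD hornerXn hornerX hornerC w1 w2 addrACA -!scalerDl addNr.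
    by rewrite !scale0r addr0.
  apply/integral_poly => i; rewrite polyC1 !coefD coefXn coefX coef1.
  by apply: integral_add; [|apply: integral_add]; exact: integral_nat.
have wO : w \in @ringO_pred K by rewrite inE; apply/asboolP.
(* The minus sign sends the simple roots to 1 and [w], whose product for the form is -1, as in
   [A_2]. *)
have hP (x : M) : (val x.1 0 ord0)%:A + (- val x.1 0 ord_max) *: w \in @ringO_pred K.
  have [u ->] := An_int x.1 ord0; have [v ->] := An_int x.1 ord_max.
  by rewrite -rmorphN; apply: ringO_comb.
pose h (x : M) : L := Subgroup (hP x).
have hB : zmod_morphism h.
  move=> x y; apply: val_inj; rewrite raddfB /= !mxE opprB !scalerBl !scaleNr.
  by rewrite opprD opprK [RHS]addrACA; congr (_ + _); rewrite addrC.
pose h' : {additive M -> L} := HB.pack h (GRing.isZmodMorphism.Build _ _ h hB).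
pose a : basic_lattice (TypeA 2) := Subgroup (delta_An (ord0 : 'I_3) (lift ord0 ord0)).
pose b : basic_lattice (TypeA 2) := Subgroup (delta_An (lift ord0 ord0 : 'I_3) ord_max).
apply: (@ringO_rank2 _ _ theta_inv (Subgroup (ringO1 K)) (Subgroup wO) [:: TypeA 2]
          h' (a, 0) (b, 0)) => //.
- move=> z zO; have [p [q Ez]] := adjoin_coords s2 s_gen z; rewrite Ez in zO *.
  have /intrP[m Em] := integral_quad_trace d_lt0 s2 cc zO.
  have /intrP[k Ek] := integral_quad_trace2 d_lt0 s2 cc zO.
  have /intrP[N EN] := integral_quad_norm d_lt0 s2 cc zO.
  rewrite d3 in Ek EN.
  have mkN : 3 * m ^+ 2 + k ^+ 2 = 12 * N.
    apply: (intr_inj (R := rat)); rewrite rmorphD [X in X + _]rmorphM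
      !rmorphXn [RHS]rmorphM /= -Em -Ek -EN.
    by rewrite -[3%:~R]/(3 : rat) -[12%:~R]/(12 : rat); ring.
  have [u [v [Eu Ev]]] := eisenstein_norm_parity mkN.
  (* Here [p = u - v / 2] and [q = - k / 6 = - v / 2], and [s = 2 w + 1] turns [p + q s] into
     [(u - v) - v w]. *)
  exists (u - v), (- v); rewrite /= -!scaler_int combE; congr (_ *: _ + _ *: _).
    by move: Em; rewrite Eu !(rmorphB, rmorphN, rmorphD, rmorphM) /=; lra.
  by move: Ek; rewrite Ev rmorphM rmorphN /=; lra.
- move=> u v; rewrite /= -!scaler_int combE => /(quad_eq0 d_lt0 s2)[E1 E2].
  have v0 : v = 0 by apply/eqP; rewrite -(intr_eq0 rat); apply/eqP; lra.
  split=> //; apply/eqP; rewrite -(intr_eq0 rat); apply/eqP.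
  by move: E1; rewrite v0; lra.
- by have := formE 1 0 1 0; rewrite !scale1r !scale0r !addr0 => /= ->.
- by have := formE 1 0 (- (1 / 2)) (1 / 2); rewrite !scale1r !scale0r addr0 => /= ->.
- by have := formE (- (1 / 2)) (1 / 2) (- (1 / 2)) (1 / 2) => /= ->.
- move=> x y; rewrite -[RHS]/(fm_form x.1 y.1 + 0) A2_form.
  rewrite -[LHS]/(trace_form theta (_ + _) (_ + _)) !combE formE d3.
  by field.
- apply: val_inj; rewrite /= !mxE /=.
  by rewrite !subr0 oppr0 scale1r scale0r addr0.
- apply: val_inj; rewrite /= !mxE /=.
by rewrite subr0 sub0r opprK scale1r scale0r add0r.
Qed.

Theorem theorem1 (K : fieldExtType rat) (theta : {rmorphism K -> K})
    (theta_inv : forall x : K, theta (theta x) = x) :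
  is_root_lattice (ringO_lattice theta) <->
  [\/ ({:K}%VS = 1%VS /\ forall x : K, theta x = x),
      (is_Q_sqrt K (- 3) /\ is_complex_conj theta)
    | (is_Q_sqrt K (- 1) /\ is_complex_conj theta)].
Proof.
split; first exact: root_lattice_cases.
case=> [[K1 th1] | [K3 cc] | [K1 cc]].
- exact: root_lattice_rational.
- exact: root_lattice_eisenstein.
- exact: root_lattice_gaussian.
Qed.
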